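(* Let $\mathcal{F}=(m_{i,j})$ be a periodic infinite frieze pattern of Type $\Lambda_{p_1,\ldots,p_s}$, with quiddity entries written as $m_{i-1,i+1}=\sum_{p\in A_i}\lambda_p$ for finite multisets $A_i$ of integers $\geq 3$. Suppose $\mathcal{F}$ is skeletal and passes the realizability test, i.e. neither of the following holds: (1) there is $i$ with $A_i\cap A_{i+1}=\emptyset$; (2) for some integer $p\geq 3$ there are more than $p-2$ consecutive indices $i$ with $A_i=\{p\}$ and there is some $j$ with $A_j\neq\{p\}$. Then $\mathcal{F}$ is realizable by a dissection of a once-punctured disc or of an annulus, or it has a quotient dissection realization on an annulus.
   Context: A frieze pattern over $\mathbb{R}$ is an array $(m_{i,j})_{i,j\in\mathbb{Z},\,j\geq i}$ of real numbers with $m_{i,i}=0$, $m_{i,i+1}=1$ and $m_{i-1,j}m_{i,j+1}-m_{i,j}m_{i+1,j+1}=1$ for all $i,j$; it is infinite if all entries with $j\ge i$ are present (no terminating row). The entries $m_{i-1,i+1}$ form the quiddity row; the pattern is $n$-periodic if $m_{i-1,i+1}=m_{i+n-1,i+n+1}$ for all $i$, and $(m_{0,2},\ldots,m_{n-1,n+1})$ is then a quiddity cycle. For an integer $p\geq3$, $\lambda_p=2\cos(\pi/p)$. The pattern is of Type $\Lambda_{p_1,\ldots,p_s}$ if each quiddity entry is a sum of positive integer multiples of $\lambda_{p_1},\ldots,\lambda_{p_s}$. An infinite frieze pattern is skeletal if every string of consecutive quiddity entries all equal to $\lambda_p$ has length smaller than $p-2$. Surfaces: $A_{n,m}$ is an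 annulus with $n\ge1$ marked points on the outer boundary and $m\ge1$ on the inner boundary; $S_n$ is a disc with $n\ge1$ marked boundary points and one puncture. Outer boundary vertices are labelled $v_1,\ldots,v_n$ counterclockwise, indices mod $n$. A dissection is a set of pairwise non-crossing arcs between marked points dividing the surface into polygons (subgons); $|\mathcal{P}|$ is the number of sides of a subgon $\mathcal{P}$. By convention no arc has both endpoints on the inner boundary of $A_{n,m}$. For a dissection, $A_i$ is the multiset of sizes of subgons incident to $v_i$, counted with multiplicity by corners at $v_i$ (e.g. a self-folded subgon counts twice). An $n$-periodic infinite frieze pattern is realizable if there is a dissection of some $A_{n,m}$ or of $S_n$ with $m_{i-1,i+1}=\sum_{p\in A_i}\lambda_p$ for all $i$. Quotient dissections: given a dissection $\mathcal{D}$ of $A_{n,m}$, a quotient dissection $\overline{\mathcal{D}}$ is obtained by iteratively identifying pairs of subgons of the same size that share a vertex on the outer boundary, where it is forbidden to identify two subgons sharing an edge and forbidden to identify subgons all of whose vertices lie on the outer boundary. For $\overline{\mathcal{D}}$, $A_i$ is the multiset of sizes of subgons incident to $v_i$ where identified subgons are counted as a single subgon. A frieze pattern has a quotient dissection realization if for some quotient dissection of some $A_{n,m}$, $m_{i-1,i+1}=\sum_{p\in A_i}\lambda_p$ for all $i$. *)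

(* Defs.v *)
From HB Require Import structures.
From mathcomp Require Import all_boot all_order all_algebra.
From mathcomp Require Import finmap multiset.
From mathcomp Require Import reals trigo.

Set Implicit Arguments.
Unset Strict Implicit.
Unset Printing Implicit Defensive.

Import Order.TTheory GRing.Theory Num.Theory.

Local Open Scope ring_scope.
Local Open Scope mset_scope.

(* An array (m_{i,j}) with j >= i is a total function on int * int whose      *)
(* values at j < i are never inspected.                                       *)

(* The last clause is the determinant rule for the diamond with entries       *)
(* m_{i-1,j}, m_{i,j+1} (left, right) and m_{i,j}, m_{i-1,j+1} (the other     *)
(* two corners).                                                              *)
Definition infinite_frieze (R : realType) (m : int -> int -> R) : Prop :=
  [/\ forall i, m i i = 0,
      forall i, m i (i + 1) = 1
    & forall i j, i <= j ->
        m (i - 1) j * m i (j + 1) - m i j * m (i - 1) (j + 1) = 1].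

Definition quiddity (R : realType) (m : int -> int -> R) (i : int) : R :=
  m (i - 1) (i + 1).

Definition n_periodic (R : realType) (n : nat) (m : int -> int -> R) : Prop :=
  forall i, quiddity m i = quiddity m (i + n%:Z).

Definition periodic_frieze (R : realType) (m : int -> int -> R) : Prop :=
  exists2 n : nat, (0 < n)%N & n_periodic n m.

Definition lambda (R : realType) (p : nat) : R := 2 * cos (pi / p%:R).

(* A given entry need not involve every lambda_{p_k}: c k = 0 means that no   *)
(* multiple of lambda_{p_k} occurs in the sum.                                *)
Definition type_Lambda (R : realType) (s : nat) (p : 'I_s -> nat)
    (m : int -> int -> R) : Prop :=
  forall i, exists2 c : 'I_s -> nat, (exists k, (0 < c k)%N)
    & quiddity m i = \sum_(k < s) lambda R (p k) *+ c k.

Definition skeletal (R : realType) (m : int -> int -> R) : Prop :=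
  forall (p : nat) (i : int) (l : nat), (3 <= p)%N ->
    (forall k : nat, (k < l)%N -> quiddity m (i + k%:Z) = lambda R p) ->
    (l < p - 2)%N.

Definition passes_realizability_test (A : int -> {mset nat}) : Prop :=
  ~ (exists i, A i `&` A (i + 1) = mset0) /\
  ~ (exists p : nat, [/\ (3 <= p)%N,
       exists i : int, exists2 l : nat, (p - 2 < l)%N
         & forall k : nat, (k < l)%N -> A (i + k%:Z) = [mset p]
     & exists j, A j <> [mset p]]).

(* Arcs, subgons and dissections are described on the universal cover, where  *)
(* isotopy classes of arcs are determined by their endpoints. The cover of    *)
(* A_{n,m} is a strip; Out i is the lift of v_(i mod n) at position i of the  *)
(* outer boundary line and Inn a the lift at position a of the inner one. The *)
(* cover of S_n, branched at the puncture, is a half-plane with outer         *)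
(* boundary points Out i and one ideal point Punct over the puncture.         *)

Inductive surface :=
  | Annulus of nat & nat
  | PuncturedDisc of nat.

Definition nonempty_boundary (S : surface) : bool :=
  match S with
  | Annulus n m => (0 < n)%N && (0 < m)%N
  | PuncturedDisc n => (0 < n)%N
  end.

Inductive vertex := Out of int | Inn of int | Punct.

Definition vertex_code (v : vertex) : int + option int :=
  match v with Out i => inl i | Inn a => inr (Some a) | Punct => inr None end.
Definition vertex_decode (c : int + option int) : vertex :=
  match c with inl i => Out i | inr (Some a) => Inn a | inr None => Punct end.
Lemma vertex_codeK : cancel vertex_code vertex_decode.
Proof. by case. Qed.
HB.instance Definition _ := Equality.copy vertex (can_type vertex_codeK).

Definition is_outer (v : vertex) : bool := if v is Out _ then true else false.

(* The counterclockwise cyclic order of the marked points on the boundary of  *)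
(* the cover, cut open at the left end: first the outer points from left to   *)
(* right, then the inner points from right to left (or the puncture).         *)
Definition vlt (u v : vertex) : bool :=
  match u, v with
  | Out i, Out j => i < j
  | Out _, _ => true
  | Inn a, Inn b => b < a
  | _, _ => false
  end.

Definition deck (S : surface) (k : int) (v : vertex) : vertex :=
  match S, v with
  | Annulus n _, Out i => Out (i + n%:Z * k)
  | Annulus _ m, Inn a => Inn (a + m%:Z * k)
  | PuncturedDisc n, Out i => Out (i + n%:Z * k)
  | _, _ => v
  end.

(* Boundary segments, oriented counterclockwise. *)
Definition boundary_segment (S : surface) (u v : vertex) : bool :=
  match S, u, v with
  | _, Out i, Out j => j == i + 1
  | Annulus _ _, Inn a, Inn b => a == b + 1
  | _, _, _ => false
  end.

(* Lifts of arcs; arcs between two points of the inner boundary are excluded, *)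
(* and so are arcs isotopic to a boundary segment. A path between Out i and   *)
(* Out j with `|i - j| > n crosses its own translates, hence is excluded by   *)
(* the non-crossing condition in [dissection] below.                          *)
Definition is_arc (S : surface) (u v : vertex) : bool :=
  match S, u, v with
  | _, Out i, Out j => 1 < `|i - j|
  | Annulus _ _, Out _, Inn _ | Annulus _ _, Inn _, Out _ => true
  | PuncturedDisc _, Out _, Punct | PuncturedDisc _, Punct, Out _ => true
  | _, _, _ => false
  end.

Definition crossing (u v x y : vertex) : bool := [&& vlt u x, vlt x v & vlt v y].

(* Sides, oriented so as to leave the polygon they bound on their left. *)
Definition side (S : surface) (D : rel vertex) : rel vertex :=
  fun u v => D u v || boundary_segment S u v.

(* A lift of a subgon, given by the counterclockwise list of its vertices.    *)
Definition subgon (S : surface) (D : rel vertex) (P : seq vertex) : Prop :=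
  [/\ (2 < size P)%N, sorted vlt P, cycle (side S D) P
    & forall u v, u \in P -> v \in P -> D u v ->
        v = next P u \/ u = next P v].

(* D is the set of all lifts of the arcs. The last clause says that the       *)
(* surface is divided into polygons: the region on the left of each side is a *)
(* subgon (for an arc this covers both regions, as D is symmetric).           *)
Definition dissection (S : surface) (D : rel vertex) : Prop :=
  nonempty_boundary S /\
  [/\ symmetric D,
      forall u v, D u v -> is_arc S u v,
      forall k u v, D (deck S k u) (deck S k v) = D u v,
      forall u v x y, D u v -> D x y -> ~~ crossing u v x y
    & forall u v, side S D u v ->
        exists2 P, subgon S D P & u \in P /\ v = next P u].

(* The corners at v_i of the subgons of D correspond to the lifted subgons    *)
(* having Out i as a vertex.                                                  *)
Definition corner (S : surface) (D : rel vertex) (i : int) (P : seq vertex) :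
    Prop :=
  subgon S D P /\ Out i \in P.

(* A is the multiset A_i of D. *)
Definition corner_sizes (S : surface) (D : rel vertex) (i : int)
    (A : {mset nat}) : Prop :=
  exists Ps : seq (seq vertex),
    [/\ uniq Ps, forall P, P \in Ps <-> corner S D i P
      & A = seq_mset [seq size P | P <- Ps]].

Definition realized_by (R : realType) (m : int -> int -> R) (S : surface)
    (D : rel vertex) : Prop :=
  forall i, exists2 A, corner_sizes S D i A
    & quiddity m i = \sum_(p <- A) lambda R p.

Definition realizable (R : realType) (m : int -> int -> R) : Prop :=
  exists n : nat, n_periodic n m /\
    ((exists n' D, dissection (Annulus n n') D /\
                   realized_by m (Annulus n n') D)
     \/ (exists D, dissection (PuncturedDisc n) D /\
                   realized_by m (PuncturedDisc n) D)).

(* P and Q are lifts of the same subgon of the surface. *)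
Definition same_subgon (S : surface) (P Q : seq vertex) : Prop :=
  exists k : int, Q = [seq deck S k v | v <- P].

Definition edge_of (P : seq vertex) (u v : vertex) : Prop :=
  [/\ u \in P, v \in P & v = next P u \/ u = next P v].

Definition share_edge (P Q : seq vertex) : Prop :=
  exists u v, edge_of P u v /\ edge_of Q u v.

Definition share_outer_vertex (P Q : seq vertex) : Prop :=
  exists i : int, Out i \in P /\ Out i \in Q.

Definition merge_classes (T : Type) (E : T -> T -> Prop) (P Q X Y : T) : Prop :=
  [\/ E X Y, E X P /\ E Q Y | E X Q /\ E P Y].

(* A quotient dissection of D is encoded by the equivalence relation E that   *)
(* the identifications generate on lifted subgons. At each step the subgons   *)
(* being identified may already be identified with other ones, whose edges    *)
(* are then edges of the identified subgon too.                               *)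
Inductive quotient_dissection (S : surface) (D : rel vertex) :
    (seq vertex -> seq vertex -> Prop) -> Prop :=
  | QuotientRefl : quotient_dissection S D (same_subgon S)
  | QuotientStep E P Q of
      quotient_dissection S D E &
      subgon S D P & subgon S D Q &
      size P = size Q &
      share_outer_vertex P Q &
      (forall P' Q', E P P' -> E Q Q' -> ~ share_edge P' Q') &
      ~~ all is_outer P & ~~ all is_outer Q :
      quotient_dissection S D (merge_classes E P Q).

(* A is the multiset A_i of the quotient dissection E of D. A class of        *)
(* identified subgons counts as one subgon, i.e. with the corners at v_i of   *)
(* only one of its members; in case several corners at v_i belong to the same *)
(* subgon of the class, the member with most corners at v_i is the one        *)
(* retained (this is what the injections f express).                          *)
Definition quotient_corner_sizes (S : surface) (D : rel vertex)
    (E : seq vertex -> seq vertex -> Prop) (i : int) (A : {mset nat}) : Prop :=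
  exists Ps : seq (seq vertex),
    [/\ uniq Ps,
        forall P, P \in Ps -> corner S D i P,
        forall P Q, P \in Ps -> Q \in Ps -> E P Q -> same_subgon S P Q,
        forall P, corner S D i P ->
          exists f : seq vertex -> seq vertex,
            (forall Q, same_subgon S P Q -> corner S D i Q ->
               f Q \in Ps /\ E Q (f Q)) /\
            (forall Q Q', same_subgon S P Q -> corner S D i Q ->
               same_subgon S P Q' -> corner S D i Q' -> f Q = f Q' -> Q = Q')
      & A = seq_mset [seq size P | P <- Ps]].

Definition has_quotient_realization (R : realType) (m : int -> int -> R) :
    Prop :=
  exists n n' D E,
    [/\ n_periodic n m, dissection (Annulus n n') D,
        quotient_dissection (Annulus n n') D E
      & forall i, exists2 A, quotient_corner_sizes (Annulus n n') D E i A
          & quiddity m i = \sum_(p <- A) lambda R p].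

(* Main.v *)
Require Import Defs.
From HB Require Import structures.
From mathcomp Require Import all_boot all_order all_algebra.
From mathcomp Require Import finmap multiset.
From mathcomp Require Import boolp reals trigo.
From mathcomp Require Import zify lra.

Set Implicit Arguments.
Unset Strict Implicit.
Unset Printing Implicit Defensive.

Import Order.TTheory GRing.Theory Num.Theory.

Local Open Scope ring_scope.
Local Open Scope mset_scope.

(* After passing to a common period, choose for each boundary segment from i  *)
(* to i + 1 a common entry e_i of A_i and A_{i+1}, the size of the subgon on  *)
(* that segment. All arcs run to the inner boundary: they leave every vertex  *)
(* with |A_i| > 1, and between the subgons on the two segments at i there are *)
(* subgons with only the vertex i on the outer boundary, of the remaining     *)
(* sizes in A_i. The skeletal condition leaves each subgon at least one inner *)
(* vertex. If one entry of A_i must serve both segments at i, the subgons on  *)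
(* them are identified, which is allowed because others lie between them. If  *)
(* no subgon has an inner edge, then nothing is identified and the inner      *)
(* boundary shrinks to a puncture.                                            *)

(** * Integer sequences *)

(** When all arcs bridge the two boundaries, the lifted polygons are linearly ordered, and the
    dissection amounts to two nondecreasing sequences, the outer and inner endpoints of the [k]-th
    arc. The polygon between consecutive arcs has two arcs, some outer edges and some inner edges as
    sides, so its size and outer endpoints determine its number of inner edges. That number is
    nonnegative: otherwise a polygon of size [p] would pass [p - 2] consecutive vertices whose
    multiset is just [p], against the skeletal condition ([polygon_width]). [bridges_dissection] and
    [bridges_subgonP] show that such data give a dissection with exactly the expected subgons.

    The identifications are legal because of a labelling that is constant on classes and separates
    neighbours ([bridge_quotient], [label_step]).

    Periodicity is assumed for the quiddity only. As [lambda p] increases to 2 without reaching it,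
    an entry has finitely many representations ([lambda_sum_finite]), so a stretch of [A] between
    two equal multisets can be repeated periodically ([periodic_prescription]). *)

Lemma int_ind_step (P : int -> Prop) :
  P 0 -> (forall x : int, P x -> P (x + 1)) ->
  (forall x : int, P (x + 1) -> P x) -> forall x : int, P x.
Proof.
move=> P0 Pup Pdown; elim/int_ind => // n IH.
  by have := Pup _ IH; rewrite -addn1 PoszD.
by apply: Pdown; rewrite (_ : _ + 1 = - n%:Z) //; lia.
Qed.

Section Sum.
Variable f : int -> int.

(** The discrete antiderivative on all integers that vanishes at 0; it turns local counts into
    positions on the cover. *)
Definition int_sum (x : int) : int :=
  match x with
  | Posz n => \sum_(j < n) f j%:Z
  | Negz n => - \sum_(j < n.+1) f (- (j.+1)%:Z)
  end.

Lemma int_sum0 : int_sum 0 = 0.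
Proof. exact: big_ord0. Qed.

Lemma int_sumS (x : int) : int_sum (x + 1) = int_sum x + f x.
Proof.
case: x => [n | [|n]].
- rewrite (_ : n%:Z + 1 = n.+1%:Z); last by lia.
  by rewrite /int_sum big_ord_recr.
- rewrite (_ : Negz 0 + 1 = 0) // int_sum0 /int_sum big_ord1.
  by rewrite NegzE addNr.
- rewrite (_ : Negz n.+1 + 1 = Negz n); last by lia.
  by rewrite /int_sum [in RHS]big_ord_recr /= opprD -addrA NegzE addNr addr0.
Qed.

Lemma int_sum_shift (q : int) : (forall x : int, f (x + q) = f x) ->
  forall x : int, int_sum (x + q) = int_sum x + int_sum q.
Proof.
move=> fq; apply: int_ind_step => [|x|x]; first by rewrite int_sum0 !add0r.
  by move=> IH; rewrite addrAC !int_sumS fq IH addrAC.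
rewrite (addrAC x) !int_sumS fq => IH.
by apply: (addIr (f x)); rewrite IH addrAC.
Qed.

End Sum.

Section Monotone.
Variable f : int -> int.

Lemma int_mono_step : (forall x : int, f x <= f (x + 1)) ->
  forall x y : int, x <= y -> f x <= f y.
Proof.
move=> fS x y xy; have -> : y = x + `|y - x|%N%:Z by lia.
elim: `|y - x|%N => [|n IH]; first by rewrite addr0.
by rewrite (_ : x + n.+1%:Z = x + n%:Z + 1); [exact: le_trans IH (fS _)|lia].
Qed.

Lemma int_smono_step : (forall x : int, f x < f (x + 1)) ->
  forall x y : int, x < y -> f x < f y.
Proof.
move=> fS x y xy; apply: lt_le_trans (fS x) _.
by apply: int_mono_step => [z|]; [exact: ltW | lia].
Qed.

Lemma quasi_periodic_mul (q c : int) : (forall x : int, f (x + q) = f x + c) ->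
  forall t x : int, f (x + q * t) = f x + c * t.
Proof.
move=> fq; apply: int_ind_step => [|t IH|t IH] x; first by rewrite !mulr0 !addr0.
  by rewrite (_ : x + _ = x + q * t + q) ?fq ?IH; lia.
by apply: (addIr c); rewrite -fq (_ : _ + q = x + q * (t + 1)) ?IH; lia.
Qed.

(** The sequence is unbounded in both directions, so it passes [k] somewhere. This finds the polygon
    on a given boundary segment, and later the vertex at which a given arc starts. *)
Lemma int_locate (q c : int) : (forall x : int, f x <= f (x + 1)) ->
  (forall x : int, f (x + q) = f x + c) -> 0 < c ->
  forall k : int, exists x : int, f x <= k < f (x + 1).
Proof.
move=> fS fq c0 k.
have fqt := quasi_periodic_mul fq.
have [z _] : exists z : int, true by exists 0.
(* Each period changes [f] by at least 1, so [u] periods on either side of [z] suffice to get past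
   [k]. *)
have [u u_ge] : exists u : int, `|k| + `|f z| + 1 <= u.
  by exists (`|k| + `|f z| + 1).
have cu : u <= c * u by rewrite -[leLHS]mul1r ler_wpM2r //; lia.
have low : f (z + q * (- u)) <= k by rewrite fqt mulrN; lia.
have high : k < f (z + q * u) by rewrite fqt; lia.
set x0 : int := z + _ in low; set x1 : int := z + _ in high.
have lt01 : x0 < x1.
  by rewrite ltNge; apply/negP => /(int_mono_step fS); lia.
have ex : exists d : nat, k < f (x0 + d%:Z).
  by exists `|x1 - x0|%N; rewrite (_ : x0 + _ = x1) //; lia.
case: (ex_minnP ex) => [[|d]]; first by rewrite addr0; lia.
move=> lt_k min_d; exists (x0 + d%:Z); apply/andP; split.
  by rewrite leNgt; apply/negP => /min_d; lia.
by rewrite (_ : _ + 1 = x0 + d.+1%:Z) //; lia.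
Qed.

End Monotone.

(** * Dissections by bridging arcs *)

Lemma vlt_trans : transitive vlt.
Proof. by move=> [y|y|] [x|x|] [z|z|] //=; lia. Qed.

Lemma vlt_irr : irreflexive vlt.
Proof. by case=> [x|x|] //=; rewrite ltxx. Qed.

Lemma vlt_boundary S u v : boundary_segment S u v -> vlt u v.
Proof. by case: S u v => [??|?] [x|x|] [y|y|] //= /eqP ->; rewrite ltrDl. Qed.

Fixpoint outs (x : int) (d : nat) : seq vertex :=
  if d is d'.+1 then Out (x + 1) :: outs (x + 1) d' else [::].

Lemma mem_outs x d v :
  v \in outs x d <-> exists2 z : int, x < z <= x + d%:Z & v = Out z.
Proof.
elim: d x v => [|d IH] x v /=; first by split=> // -[z]; lia.
rewrite inE; split=> [/predU1P[->|/IH[z zP ->]] | [z zP ->]].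
- by exists (x + 1) => //; lia.
- by exists z => //; lia.
have [->|neq] := eqVneq z (x + 1); first by rewrite eqxx.
by apply/orP; right; apply/IH; exists z => //; lia.
Qed.

Lemma size_outs x d : size (outs x d) = d.
Proof. by elim: d x => //= d IH x; rewrite IH. Qed.

Lemma last_outs x d : last (Out x) (outs x d) = Out (x + d%:Z).
Proof.
by elim: d x => [|d IH] x /=; [rewrite addr0 | rewrite IH; congr Out; lia].
Qed.

Lemma path_outs (e : rel vertex) x d :
  (forall z : int, e (Out z) (Out (z + 1))) -> path e (Out x) (outs x d).
Proof. by move=> e_succ; elim: d x => //= d IH x; rewrite e_succ IH. Qed.

Lemma path_outs_step (e : rel vertex) x d : path e (Out x) (outs x d) ->
  forall z : int, x <= z < x + d%:Z -> e (Out z) (Out (z + 1)).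
Proof.
elim: d x => [|d IH] x /=; first by move=> _ z; lia.
move=> /andP[ex /IH e_step] z zP.
have [->//|neq] := eqVneq z x; apply: e_step; lia.
Qed.

(* The arc k joins Out (o k) to the inner point a k; when m = 0 there is no   *)
(* inner boundary and every arc ends at the puncture.                         *)
Record bridging (n m : nat) (o a : int -> int) (K : int) : Prop := Bridging {
  bridging_outer : (0 < n)%N;
  bridging_period : 0 < K;
  bridging_o_step : forall k : int, o k <= o (k + 1);
  bridging_a_step : forall k : int, a k <= a (k + 1);
  bridging_step : forall k : int, o k + a k < o (k + 1) + a (k + 1);
  bridging_o_period : forall k : int, o (k + K) = o k + n%:Z;
  bridging_a_period : forall k : int, a (k + K) = a k + m%:Z }.

Section Bridging.
Variables (n m : nat) (o a : int -> int) (K : int).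
Hypothesis B : bridging n m o a K.

Let n_gt0 := bridging_outer B.
Let K_gt0 := bridging_period B.
Let oS := bridging_o_step B.
Let aS := bridging_a_step B.
Let oaS := bridging_step B.
Let oK := bridging_o_period B.
Let aK := bridging_a_period B.

Definition bridged_surface : surface :=
  if (0 < m)%N then Annulus n m else PuncturedDisc n.

Definition inner_point (y : int) : vertex :=
  if (0 < m)%N then Inn y else Punct.

Definition bridges : rel vertex := fun u v =>
  `[< exists k : int, (u = Out (o k) /\ v = inner_point (a k)) \/
                      (u = inner_point (a k) /\ v = Out (o k)) >].

Local Notation S := bridged_surface.
Local Notation inn := inner_point.
Local Notation D := bridges.

Fixpoint inners (y : int) (d : nat) : seq vertex :=
  if d is d'.+1 then inn (y - 1) :: inners (y - 1) d' else [::].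

(* The polygon bounded by the arcs k and l. *)
Definition span_polygon (k l : int) : seq vertex :=
  Out (o k) :: outs (o k) `|o l - o k|%N ++
  inn (a l) :: inners (a l) `|a l - a k|%N.

Definition bridge_polygon (k : int) := span_polygon k (k + 1).

Let o_mono (k l : int) : k <= l -> o k <= o l.
Proof. exact: int_mono_step. Qed.

Let a_mono (k l : int) : k <= l -> a k <= a l.
Proof. exact: int_mono_step. Qed.

Let oa_mono (k l : int) : k < l -> o k + a k < o l + a l.
Proof. exact: (@int_smono_step (fun j => o j + a j)). Qed.

(** A nondecreasing periodic sequence is constant; hence collapsing the inner points to [Punct]
    loses nothing about the arcs. *)
Let a_const : m = 0%N -> forall k l : int, a k = a l.
Proof.
move=> m0; have step (k : int) : a (k + 1) = a k.
  apply/eqP; rewrite eq_le aS andbT.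
  by have := aK k; rewrite m0 addr0 => <-; apply: a_mono; lia.
suff a0 (k : int) : a k = a 0 by move=> k l; rewrite !a0.
by elim/int_ind_step: k => // k; rewrite step.
Qed.

Let inn_inj (k l : int) : inn (a k) = inn (a l) -> a k = a l.
Proof.
rewrite /inn; case: posnP => [m0 _|_ [//]]; exact: a_const.
Qed.

Lemma mem_inners y d v :
  v \in inners y d <-> exists2 z : int, y - d%:Z <= z < y & v = inn z.
Proof.
elim: d y v => [|d IH] y v /=; first by split=> // -[z]; lia.
rewrite inE; split=> [/predU1P[->|/IH[z zP ->]] | [z zP ->]].
- by exists (y - 1) => //; lia.
- by exists z => //; lia.
have [->|neq] := eqVneq z (y - 1); first by rewrite eqxx.
by apply/orP; right; apply/IH; exists z => //; lia.
Qed.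

Lemma size_inners y d : size (inners y d) = d.
Proof. by elim: d y => //= d IH y; rewrite IH. Qed.

Lemma last_inners y d : last (inn y) (inners y d) = inn (y - d%:Z).
Proof.
by elim: d y => [|d IH] y /=; [rewrite subr0 | rewrite IH; congr inn; lia].
Qed.

Lemma path_inners (e : rel vertex) y d :
  ((0 < d)%N -> forall z : int, e (inn z) (inn (z - 1))) ->
  path e (inn y) (inners y d).
Proof.
move=> e_pred; elim: d y e_pred => //= d IH y e_pred.
by rewrite e_pred // IH // => _; apply: e_pred.
Qed.

Lemma path_inners_step (e : rel vertex) y d : path e (inn y) (inners y d) ->
  forall z : int, y - d%:Z < z <= y -> e (inn z) (inn (z - 1)).
Proof.
elim: d y => [|d IH] y /=; first by move=> _ z; lia.
move=> /andP[ey /IH e_step] z zP.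
have [->//|neq] := eqVneq z y; apply: e_step; lia.
Qed.

Lemma mem_span (k l : int) v : k <= l ->
  v \in span_polygon k l <->
  (exists2 z : int, o k <= z <= o l & v = Out z) \/
  (exists2 z : int, a k <= z <= a l & v = inn z).
Proof.
move=> kl; have ok := o_mono kl; have ak := a_mono kl.
rewrite /span_polygon inE mem_cat inE; split.
  case/orP=> [/eqP->|/orP[/mem_outs[z zP ->]|/predU1P[->|/mem_inners[z zP ->]]]].
  - by left; exists (o k) => //; lia.
  - by left; exists z => //; lia.
  - by right; exists (a l) => //; lia.
  - by right; exists z => //; lia.
case=> -[z zP ->].
  have [->|neq] := eqVneq z (o k); first by rewrite eqxx.
  apply/orP; right; apply/orP; left; apply/mem_outs; exists z => //; lia.
have [->|neq] := eqVneq z (a l); first by rewrite eqxx !orbT.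
apply/orP; right; apply/orP; right; apply/orP; right.
by apply/mem_inners; exists z => //; lia.
Qed.

Lemma size_span (k l : int) : k <= l ->
  (size (span_polygon k l))%:Z = (o l - o k) + (a l - a k) + 2.
Proof.
move=> kl; have ok := o_mono kl; have ak := a_mono kl.
rewrite /span_polygon /= size_cat /= size_outs size_inners; lia.
Qed.

Let span_cycle (e : rel vertex) (k l : int) : k <= l ->
  cycle e (span_polygon k l) =
  [&& path e (Out (o k)) (outs (o k) `|o l - o k|%N),
      e (Out (o l)) (inn (a l)),
      path e (inn (a l)) (inners (a l) `|a l - a k|%N) &
      e (inn (a k)) (Out (o k))].
Proof.
move=> kl; have ok := o_mono kl; have ak := a_mono kl.
rewrite /span_polygon /= rcons_cat cat_path /= last_outs rcons_path last_inners.
rewrite (_ : o k + _ = o l); last by lia.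
by rewrite (_ : a l - `|_|%N%:Z = a k); last by lia.
Qed.

Let inner_step_annular (k l : int) :
  (0 < `|a l - a k|)%N -> (0 < m)%N.
Proof. by case: (posnP m) => // /a_const/(_ k l) ->; rewrite subrr. Qed.

Lemma span_sorted (k l : int) : k <= l -> sorted vlt (span_polygon k l).
Proof.
move=> kl; rewrite /span_polygon /= cat_path /= last_outs.
rewrite path_outs; last by move=> z /=; lia.
rewrite path_inners; last first.
  by move=> /inner_step_annular m0 z; rewrite /inn m0 /=; lia.
by rewrite /inn; case: ifP.
Qed.

Lemma span_uniq (k l : int) : k <= l -> uniq (span_polygon k l).
Proof. by move=> /span_sorted; apply: sorted_uniq vlt_trans vlt_irr _. Qed.

Lemma bridges_arc k :
  D (Out (o k)) (inn (a k)) /\ D (inn (a k)) (Out (o k)).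
Proof. by split; apply/asboolP; exists k; [left|right]. Qed.

Lemma bridges_inv u v : D u v -> exists k : int,
  (u = Out (o k) /\ v = inn (a k)) \/ (u = inn (a k) /\ v = Out (o k)).
Proof. by move/asboolP. Qed.

Lemma span_side_cycle (k l : int) : k <= l -> cycle (side S D) (span_polygon k l).
Proof.
move=> kl; rewrite span_cycle //; apply/and4P; split.
- by apply: path_outs => z; rewrite /side /S; case: ifP => _ /=; rewrite eqxx orbT.
- by rewrite /side (bridges_arc l).1.
- apply: path_inners => /inner_step_annular m0 z.
  by rewrite /side /S /inn m0 /= subrK eqxx orbT.
- by rewrite /side (bridges_arc k).2.
Qed.

Lemma next_span (k l : int) : k <= l ->
  [/\ forall z : int, o k <= z < o l ->
        next (span_polygon k l) (Out z) = Out (z + 1),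
      next (span_polygon k l) (Out (o l)) = inn (a l),
      forall z : int, a k < z <= a l ->
        next (span_polygon k l) (inn z) = inn (z - 1)
    & next (span_polygon k l) (inn (a k)) = Out (o k)].
Proof.
move=> kl; have ok := o_mono kl; have ak := a_mono kl.
have := cycle_next (span_uniq kl); rewrite span_cycle // => /and4P[]/=.
move=> outs_next /eqP next_l inners_next /eqP next_k; split=> // z zP.
  by apply/eqP; apply: (path_outs_step outs_next); lia.
by apply/eqP; apply: (path_inners_step inners_next); lia.
Qed.

Lemma mem_span_inn (j k l : int) : k <= l -> inn (a j) \in span_polygon k l ->
  a k <= a j <= a l.
Proof.
move=> kl /(mem_span _ kl)[[z _]|[z]]; rewrite /inn; case: posnP => // m0.
  by rewrite !(a_const m0 _ j) lexx.
by move=> zP [->].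
Qed.

Lemma mem_span_out (j k l : int) : k <= l ->
  Out j \in span_polygon k l = (o k <= j <= o l).
Proof.
move=> kl; apply/idP/idP => [|jP].
  case/(mem_span _ kl) => [[z zP [->]//]|[z _]].
  by rewrite /inn; case: ifP.
by apply/(mem_span _ kl); left; exists j.
Qed.

Lemma oa_between (j k l : int) : o k <= o j <= o l -> a k <= a j <= a l ->
  k <= j <= l.
Proof.
move=> oP aP; apply/andP; split; rewrite leNgt; apply/negP => /oa_mono; lia.
Qed.

Lemma bridge_polygon_subgon (k : int) : subgon S D (bridge_polygon k).
Proof.
have kl : k <= k + 1 by lia.
have [_ next_l _ next_k] := next_span kl.
have arc_next (j : int) : Out (o j) \in bridge_polygon k ->
    inn (a j) \in bridge_polygon k -> j = k \/ j = k + 1.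
  rewrite mem_span_out // => oP /(mem_span_inn kl) aP.
  by have := oa_between oP aP; lia.
split; [|exact: span_sorted|exact: span_side_cycle|].
  by have := size_span kl; have := oaS k; rewrite /bridge_polygon; lia.
move=> u v uP vP /bridges_inv[j [[uE vE]|[uE vE]]]; rewrite {}uE {}vE in uP vP *.
  by case: (arc_next j uP vP) => ->; [right|left].
by case: (arc_next j vP uP) => ->; [left|right].
Qed.

Lemma deck_out (t x : int) : deck S t (Out x) = Out (x + n%:Z * t).
Proof. by rewrite /S; case: ifP. Qed.

Lemma deck_inn (t y : int) : deck S t (inn y) = inn (y + m%:Z * t).
Proof. by rewrite /S /inn; case: ifP. Qed.

Lemma deckK (t : int) : cancel (deck S t) (deck S (- t)).
Proof.
move=> v; rewrite /S; case: ifP => _; case: v => //= x; congr (_ _);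
  by rewrite mulrN addrK.
Qed.

Lemma bridges_deck (t : int) u v : D (deck S t u) (deck S t v) = D u v.
Proof.
have shift (s : int) x y : D x y -> D (deck S s x) (deck S s y).
  case/bridges_inv=> k [[-> ->]|[-> ->]]; rewrite deck_out deck_inn;
  rewrite -(quasi_periodic_mul oK) -(quasi_periodic_mul aK);
  by case: (bridges_arc (k + K * s)).
apply/idP/idP => [/(shift (- t))|/shift//].
by rewrite !deckK.
Qed.

(** Arcs do not cross because both of their endpoints move in the same direction as the index
    grows. *)
Lemma bridges_dissection : dissection S D.
Proof.
split; first by rewrite /S; case: ifP => /= [->|]; rewrite n_gt0.
split; [| |exact: bridges_deck| |].
- move=> u v; apply/idP/idP => /bridges_inv[k [[-> ->]|[-> ->]]];
  by case: (bridges_arc k).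
- move=> u v /bridges_inv[k [[-> ->]|[-> ->]]];
  by rewrite /S /inn; case: ifP.
- move=> u v x y /bridges_inv[k [[-> ->]|[-> ->]]]
    /bridges_inv[l [[-> ->]|[-> ->]]]; apply/negP; rewrite /crossing /inn.
  + case: ifP => _ /and3P[]//= lt_o _; have [/o_mono|/ltW/a_mono] := leP l k; lia.
  + by case: ifP => _ /and3P[].
  + by case: ifP => _ /and3P[].
  + by case: ifP => _ /and3P[].
move=> u v /orP[/bridges_inv[k [[-> ->]|[-> ->]]]|].
(* Traversed from the outer boundary inwards, an arc has the preceding polygon on its left. *)
- move: (k - 1) (subrK 1 k) => j <-; have kl : j <= j + 1 by lia.
  exists (bridge_polygon j); first exact: bridge_polygon_subgon.
  have [_ next_l _ _] := next_span kl; rewrite /bridge_polygon.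
  by rewrite next_l mem_span_out // oS lexx.
- have kl : k <= k + 1 by lia.
  exists (bridge_polygon k); first exact: bridge_polygon_subgon.
  have [_ _ _ next_k] := next_span kl; rewrite /bridge_polygon.
  rewrite next_k; split=> //; apply/(mem_span _ kl); right.
  by exists (a k) => //; rewrite lexx aS.
case: u v => [i|y|] [j|z|] //; last 1 first.
all: try by rewrite /S; case: ifP.
- rewrite (_ : boundary_segment _ _ _ = (j == i + 1)); last first.
    by rewrite /S; case: ifP.
  move=> /eqP ->; have n0 : 0 < n%:Z by lia.
  have [k kP] := int_locate oS oK n0 i.
  have kl : k <= k + 1 by lia.
  exists (bridge_polygon k); first exact: bridge_polygon_subgon.
  have [next_o _ _ _] := next_span kl; rewrite /bridge_polygon next_o //.
  by rewrite mem_span_out //; split=> //; lia.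
rewrite /S; case: (posnP m) => //= m0 /eqP ->.
have m0' : 0 < m%:Z by lia.
have [k kP] := int_locate aS aK m0' z.
have kl : k <= k + 1 by lia.
have innE x : Inn x = inn x by rewrite /inn m0.
exists (bridge_polygon k); first by have := bridge_polygon_subgon k; rewrite /S m0.
have [_ _ next_i _] := next_span kl; rewrite /bridge_polygon !innE next_i; last by lia.
rewrite addrK; split=> //; apply/(mem_span _ kl); right.
by exists (z + 1) => //; lia.
Qed.

(** In the order [vlt] all outer points come first, so an increasing path that has reached the inner
    side cannot return along an arc: it follows the inner boundary, or stops at the puncture. *)
Lemma inners_path_inv (y z : int) p : path (side S D) (inn y) p ->
  path vlt (inn y) p -> last (inn y) p = inn z ->
  exists d : nat,
    [/\ p = inners y d, inn z = inn (y - d%:Z) & m = 0%N -> d = 0%N].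
Proof.
elim: p y => [|v p IH] y /=; first by move=> _ _ <-; exists 0%N; rewrite subr0.
move=> /andP[uv pv] /andP[lt_uv lt_p] last_z.
have [m0 vE] : (0 < m)%N /\ v = inn (y - 1).
  case/orP: uv lt_uv => [/bridges_inv[k [[]|[_ ->]]]|].
  - by rewrite /inn; case: ifP.
  - by rewrite /inn; case: ifP.
  rewrite /S /inn; case: posnP => // m0; case: v {pv lt_p last_z} => //= x.
  by move=> /eqP -> _; rewrite addrK.
rewrite {}vE in pv lt_p last_z *.
have [d [-> zE _]] := IH _ pv lt_p last_z.
by exists d.+1; split=> //; [rewrite zE; congr inn | move: m0]; lia.
Qed.

Lemma outs_path_inv (x z : int) p : path (side S D) (Out x) p ->
  path vlt (Out x) p -> last (Out x) p = inn z ->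
  exists (l : int) (d e : nat),
    [/\ p = outs x d ++ inn (a l) :: inners (a l) e, o l = x + d%:Z,
        inn z = inn (a l - e%:Z) & m = 0%N -> e = 0%N].
Proof.
elim: p x => [|v p IH] x /=; first by rewrite /inn; case: ifP.
move=> /andP[/orP[/bridges_inv[k [[[xE] vE]|[xE _]]]|uv] pv] /andP[lt_uv lt_p] last_z.
- rewrite {}vE in pv lt_p last_z *.
  have [e [-> zE e0]] := inners_path_inv pv lt_p last_z.
  by exists k, 0%N, e; rewrite addr0.
- by move: xE; rewrite /inn; case: ifP.
have vE : v = Out (x + 1).
  by move: uv lt_uv; rewrite /S; case: ifP => _; case: (v) => //= y /eqP->.
rewrite {}vE in pv lt_p last_z *.
have [l [d [e [-> olE zE e0]]]] := IH _ pv lt_p last_z.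
by exists l, d.+1, e; split=> //; lia.
Qed.

(** A sorted cycle of sides consists of an outer stretch, one arc, an inner stretch and a closing
    arc, so it is a [span_polygon]; having no diagonals, it spans consecutive arcs. *)
Lemma bridges_subgonP P : subgon S D P -> exists k : int, P = bridge_polygon k.
Proof.
case: P => [|u p] [] // size_p sorted_p cycle_p no_diag.
move: cycle_p; rewrite /= rcons_path => /andP[path_p closing].
(* The closing side decreases in the order vlt, so it is an arc. *)
have [k [uE lastE]] : exists k : int, u = Out (o k) /\ last u p = inn (a k).
  have lt_last : vlt u (last u p).
    have := order_path_min vlt_trans sorted_p => /allP; apply.
    by case: (p) size_p => // v p' _ /=; apply: mem_last.
  case/orP: closing => [/bridges_inv[k [[lE uE]|[-> ->]]]|]; last 1 first.
  - by move=> /vlt_boundary/(vlt_trans lt_last); rewrite vlt_irr.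
  - by move: lt_last; rewrite lE uE /inn; case: ifP.
  by exists k.
rewrite {}uE in size_p sorted_p path_p lastE no_diag closing *.
have [l [d [e [pE olE aE e0]]]] := outs_path_inv path_p sorted_p lastE.
have alE : a k = a l - e%:Z.
  move: aE; rewrite /inn; case: posnP => [m0 _|m0 [->//]].
  by rewrite (e0 m0) subr0; apply: a_const.
have PE : Out (o k) :: p = span_polygon k l.
  rewrite /span_polygon pE (_ : `|o l - o k|%N = d); last by lia.
  by rewrite (_ : `|a l - a k|%N = e) //; lia.
have kl : k < l.
  rewrite ltNge; apply/negP; rewrite le_eqVlt => /predU1P[lk|/oa_mono]; last by lia.
  have /size_span : k <= l by lia.
  by move: size_p; rewrite -PE lk /=; lia.
have le_kl : k <= l by lia.
exists k; rewrite PE /bridge_polygon; congr span_polygon.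
rewrite PE in no_diag.
(* The arc [k + 1] has both ends in the polygon, so it is a side. It differs from the arc [k], hence
   it is the arc [l]. *)
have /no_diag : Out (o (k + 1)) \in span_polygon k l.
  by rewrite mem_span_out // !o_mono //; lia.
have inP : inn (a (k + 1)) \in span_polygon k l.
  by apply/(mem_span _ le_kl); right; exists (a (k + 1)); rewrite ?a_mono //; lia.
move/(_ _ inP (bridges_arc _).1).
have [next_o next_l next_i next_k] := next_span le_kl.
have no_innOut y x : inn y <> Out x by rewrite /inn; case: ifP.
have ok1 : o (k + 1) <= o l by apply: o_mono; lia.
have ak1 : a (k + 1) <= a l by apply: a_mono; lia.
have := oaS k; have := oS k; have := aS k => akS okS oakS.
case=> [next1|next1].
  have o_eq : o (k + 1) = o l.
    apply/eqP; rewrite eq_le ok1 leNgt; apply/negP => lt_o.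
    by move: next1; rewrite next_o ?lt_o ?okS //; apply: no_innOut.
  move: next1; rewrite o_eq next_l => /inn_inj a_eq.
  have : k + 1 <= l by lia.
  by rewrite le_eqVlt => /predU1P[->//|/oa_mono]; lia.
have a_eq : a (k + 1) = a k.
  apply/eqP; rewrite eq_le akS andbT leNgt; apply/negP => lt_a.
  by move: next1; rewrite next_i ?lt_a ?ak1 // => /esym; apply: no_innOut.
by move: next1; rewrite a_eq next_k => -[]; lia.
Qed.

Lemma bridge_polygon_inj : injective bridge_polygon.
Proof.
move=> k l eq_kl.
have o_eq : o k = o l by case: eq_kl.
have a_eq : a k = a l.
  have lastE (j : int) : last (Out 0) (bridge_polygon j) = inn (a j).
    rewrite /bridge_polygon /span_polygon /= last_cat /= last_inners.
    by have := aS j => ?; congr inn; lia.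
  by apply: inn_inj; rewrite -!lastE eq_kl.
by have /andP[] : k <= l <= k; [apply: oa_between; rewrite ?o_eq ?a_eq lexx|lia].
Qed.

Lemma bridge_cornerP (i : int) P : corner S D i P <->
  exists2 k : int, P = bridge_polygon k & o k <= i <= o (k + 1).
Proof.
have kS (k : int) : k <= k + 1 by lia.
split=> [[/bridges_subgonP[k ->]]|[k -> iP]].
  by rewrite mem_span_out // => iP; exists k.
by split; [exact: bridge_polygon_subgon | rewrite mem_span_out].
Qed.

Lemma size_bridge_polygon (k : int) :
  (size (bridge_polygon k))%:Z = o (k + 1) - o k + (a (k + 1) - a k) + 2.
Proof. by apply: size_span; lia. Qed.

Lemma bridge_polygon_deck (k t : int) :
  [seq deck S t v | v <- bridge_polygon k] = bridge_polygon (k + K * t).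
Proof.
have map_outs x d : map (deck S t) (outs x d) = outs (x + n%:Z * t) d.
  by elim: d x => //= d IH x; rewrite IH deck_out addrAC.
have map_inners x d : map (deck S t) (inners x d) = inners (x + m%:Z * t) d.
  by elim: d x => //= d IH x; rewrite IH deck_inn addrAC.
rewrite /bridge_polygon /span_polygon /= map_cat /= map_outs map_inners.
rewrite deck_out deck_inn (addrAC k).
rewrite !(quasi_periodic_mul oK) !(quasi_periodic_mul aK).
by congr (_ :: outs _ `|_|%N ++ _ :: inners _ `|_|%N);
  rewrite opprD addrACA subrr addr0.
Qed.

Lemma same_subgon_bridgeP (k : int) Q : same_subgon S (bridge_polygon k) Q ->
  exists t : int, Q = bridge_polygon (k + K * t).
Proof. by case=> t ->; exists t; rewrite bridge_polygon_deck. Qed.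

Lemma same_subgon_refl P : same_subgon S P P.
Proof.
exists 0; rewrite -[LHS]map_id; apply: eq_map => v.
by rewrite /S; case: ifP => _; case: v => //= x; rewrite mulr0 addr0.
Qed.

Lemma same_subgon_sym P Q : same_subgon S P Q -> same_subgon S Q P.
Proof. by case=> t ->; exists (- t); rewrite (mapK (deckK t)). Qed.

Lemma same_subgon_trans P Q T :
  same_subgon S P Q -> same_subgon S Q T -> same_subgon S P T.
Proof.
case=> t -> [s ->]; exists (t + s); rewrite -map_comp; apply: eq_map => v /=.
by rewrite /S; case: ifP => _; case: v => //= x; rewrite mulrDr addrA.
Qed.

Lemma bridge_polygon_not_outer (k : int) : ~~ all is_outer (bridge_polygon k).
Proof.
apply/negP => /allP/(_ (inn (a k))).
rewrite /inn; have [m0|m0] := posnP m; move=> H; suff: false by [].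
  by apply: H; apply/mem_span; [lia|right; exists (a k)];
    rewrite ?lexx ?aS /inn ?m0.
by apply: H; apply/mem_span; [lia|right; exists (a k)];
  rewrite ?lexx ?aS /inn ?m0.
Qed.

(** * Identification of bridge polygons on an annulus *)

Hypothesis m_gt0 : (0 < m)%N.

Let innE (y : int) : inn y = Inn y. Proof. by rewrite /inn m_gt0. Qed.

(** If [k + 1 < l], the two polygons have at most one outer and at most one inner point in common,
    and not both, since [o + a] grows strictly from [k + 1] to [l]. An edge needs two distinct
    common vertices. *)
Lemma bridge_share_edge (k l : int) :
  share_edge (bridge_polygon k) (bridge_polygon l) ->
  k <= l <= k + 1 \/ l <= k <= l + 1.
Proof.
move=> [u [v [[uk vk uv] [ul vl _]]]].
have neq_uv : u <> v.
  have irr w : side S D w w = false.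
    apply/negP=> /orP[/bridges_inv[j [[-> ]|[->]]]|/vlt_boundary].
    - by rewrite innE.
    - by rewrite innE.
    by rewrite vlt_irr.
  have cyc := span_side_cycle (_ : k <= k + 1).
  case: uv => [vE|uE] uv.
    have := next_cycle (cyc ltac:(lia)) uk; rewrite -/(bridge_polygon k) -vE uv.
    by rewrite irr.
  have := next_cycle (cyc ltac:(lia)) vk; rewrite -/(bridge_polygon k) -uE uv.
  by rewrite irr.
wlog kl : k l uk vk ul vl {uv} / k <= l.
  move=> H; have [kl|lk] : k <= l \/ l <= k by lia.
    exact: H.
  by case: (H l k) => //; [right|left].
left; rewrite kl leNgt; apply/negP => lt_kl.
have kS (j : int) : j <= j + 1 by lia.
have ok1 : o (k + 1) <= o l by apply: o_mono; lia.
have ak1 : a (k + 1) <= a l by apply: a_mono; lia.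
have := oa_mono lt_kl.
move: uk vk ul vl neq_uv => /(mem_span _ (kS k))[[x xP ->]|[x xP ->]]
  /(mem_span _ (kS k))[[y yP ->]|[y yP ->]]
  /(mem_span _ (kS l))[[x' x'P xE]|[x' x'P xE]]
  /(mem_span _ (kS l))[[y' y'P yE]|[y' y'P yE]]; move: xE yE; rewrite ?innE //.
- by move=> [?] [?] neq; case: neq; congr Out; lia.
- by move=> [?] [?] _; lia.
- by move=> [?] [?] _; lia.
- by move=> [?] [?] neq; case: neq; congr Inn; lia.
Qed.

Record equivalence (E : seq vertex -> seq vertex -> Prop) : Prop := {
  equivalence_sym : forall X Y, E X Y -> E Y X;
  equivalence_trans : forall X Y Z, E X Y -> E Y Z -> E X Z }.

Lemma merge_classes_equivalence E P Q :
  equivalence E -> equivalence (merge_classes E P Q).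
Proof.
case=> Esym Etrans; split.
  move=> X Y [XY|[XP QY]|[XQ PY]].
  - by constructor 1; apply: Esym.
  - by constructor 3; split; apply: Esym.
  - by constructor 2; split; apply: Esym.
move=> X Y Z [XY|[XP QY]|[XQ PY]] [YZ|[YP QZ]|[YQ PZ]].
- by constructor 1; apply: Etrans YZ.
- by constructor 2; split=> //; apply: Etrans YP.
- by constructor 3; split=> //; apply: Etrans YQ.
- by constructor 2; split=> //; apply: Etrans YZ.
- by constructor 2.
- by constructor 1; apply: Etrans PZ.
- by constructor 3; split=> //; apply: Etrans YZ.
- by constructor 1; apply: Etrans QZ.
- by constructor 3.
Qed.

(* Redundant identifications have to be skipped, since a subgon shares its    *)
(* edges with itself. The labels separate adjacent polygons, so an            *)
(* identification that is not redundant is never forbidden.                   *)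
Lemma bridge_quotient (T : Type) (phi : int -> T) (pairs : seq (int * int)) :
  (forall k : int, phi (k + K) = phi k) ->
  (forall k : int, phi k <> phi (k + 1)) ->
  (forall k l : int, (k, l) \in pairs ->
     [/\ phi k = phi l, size (bridge_polygon k) = size (bridge_polygon l)
       & share_outer_vertex (bridge_polygon k) (bridge_polygon l)]) ->
  exists E, [/\ quotient_dissection S D E,
    equivalence E,
    forall X Y, same_subgon S X Y -> E X Y,
    forall k l : int, (k, l) \in pairs -> E (bridge_polygon k) (bridge_polygon l)
  & forall (k : int) Y, E (bridge_polygon k) Y ->
      exists2 l : int, Y = bridge_polygon l & phi k = phi l].
Proof.
move=> phiK phiS; elim: pairs => [|[k l] pairs IH] pairsP.
  exists (same_subgon S); split=> //; first by constructor.
    by split; [exact: same_subgon_sym|exact: same_subgon_trans].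
  move=> k Y /same_subgon_bridgeP[t ->]; exists (k + K * t) => //.
  elim/int_ind_step: t => [|t ->|t ->]; first by rewrite mulr0 addr0.
    by rewrite -phiK; congr phi; lia.
  by rewrite -[RHS]phiK; congr phi; lia.
have [|E [quotE equivE subE pairsE phiE]] := IH.
  by move=> k' l' kl_in; apply: pairsP; rewrite inE kl_in orbT.
have [phi_kl size_kl share_kl] := pairsP k l (mem_head _ _).
have [Ekl|nEkl] := pselect (E (bridge_polygon k) (bridge_polygon l)).
  by exists E; split=> // k' l' /predU1P[[-> ->]|/pairsE].
exists (merge_classes E (bridge_polygon k) (bridge_polygon l)); split.
- apply: QuotientStep => //; try exact: bridge_polygon_subgon;
    try exact: bridge_polygon_not_outer.
  move=> P Q EP EQ; have [k' Pk phik] := phiE _ _ EP.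
  have [l' Ql phil] := phiE _ _ EQ; rewrite {}Pk {}Ql in EP EQ *.
  move=> /bridge_share_edge kl'.
  have eq_kl : k' = l'.
    have phi_eq : phi k' = phi l' by rewrite -phik -phil.
    have [//|neq] := eqVneq k' l'; case: kl' => kl'.
      by case: (phiS k'); rewrite phi_eq; congr phi; lia.
    by case: (phiS l'); rewrite -phi_eq; congr phi; lia.
  apply: nEkl; apply: (equivalence_trans equivE) EP _.
  by rewrite eq_kl; apply: (equivalence_sym equivE).
- exact: merge_classes_equivalence.
- by move=> X Y /subE; constructor 1.
- move=> k' l' /predU1P[[-> ->]|/pairsE Ekl]; last by constructor 1.
  by constructor 2; split; apply: subE; apply: same_subgon_refl.
- move=> j Y [/phiE//|[/phiE[k' /bridge_polygon_inj <- phij]]|].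
    by move/phiE=> [l' -> phil]; exists l'; rewrite // phij phi_kl.
  move=> [/phiE[k' /bridge_polygon_inj <- phij]].
  by move/phiE=> [l' -> phil]; exists l'; rewrite // phij -phi_kl.
Qed.

End Bridging.

(** * Polygons prescribed by a periodic sequence of multisets *)

Section Prescribed.
Variables (N : nat) (W : int -> seq nat).
Hypothesis N_gt0 : (0 < N)%N.
Hypothesis WN : forall i : int, W (i + N%:Z) = W i.
Hypothesis W_ge3 : forall (i : int) (p : nat), p \in W i -> (3 <= p)%N.
Hypothesis W_common : forall i : int, has (mem (W (i + 1))) (W i).
Hypothesis W_no_run : forall (p : nat) (i : int), (3 <= p)%N ->
  ~ (forall k : nat, (k < p - 2)%N -> W (i + k%:Z) = [:: p]).

(* The size of the polygon on the boundary segment from i to i + 1. *)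
Definition edge_size (i : int) : nat :=
  head 0%N [seq p <- W i | p \in W (i + 1)].

Definition spoke (i : int) : bool := (1 < size (W i))%N.

(* A single entry of W i accounts for both boundary segments at i, although   *)
(* other entries separate the two polygons there.                             *)
Definition glued (i : int) : bool :=
  [&& spoke i, edge_size (i - 1) == edge_size i
    & count_mem (edge_size i) (W i) == 1%N].

(* The sizes of the polygons at i lying to the right of the first arc at i.   *)
Definition block (i : int) : seq nat :=
  if spoke i then
    rcons (rem (edge_size i)
             (if glued i then W i else rem (edge_size (i - 1)) (W i)))
          (edge_size i)
  else [::].

Local Notation e := edge_size.

Lemma edge_size_mem (i : int) : e i \in W i /\ e i \in W (i + 1).
Proof.
suff : e i \in [seq p <- W i | p \in W (i + 1)] by rewrite mem_filter => /andP[].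
rewrite /e; have := W_common i; rewrite has_filter.
by case: [seq _ <- _ | _] => // x t _; rewrite mem_head.
Qed.

Lemma edge_size_ge3 (i : int) : (3 <= e i)%N.
Proof. by have [/W_ge3] := edge_size_mem i. Qed.

Let edge_size_pred (i : int) : e (i - 1) \in W i.
Proof. by have [_] := edge_size_mem (i - 1); rewrite subrK. Qed.

Lemma not_spokeP (i : int) : ~~ spoke i -> W i = [:: e i] /\ e (i - 1) = e i.
Proof.
have [ei _] := edge_size_mem i; have ei1 := edge_size_pred i; rewrite /spoke.
case: (W i) ei ei1 => [|x [|y t]] //=; rewrite !inE => /eqP ei /eqP ei1 _.
by rewrite ei1 ei.
Qed.

(** Here the polygon before the first arc is in excess; identifying it with the last polygon of the
    block removes the surplus. *)
Lemma block_glued (i : int) : glued i -> perm_eq (block i) (W i).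
Proof.
move=> gi; have /and3P[si _ _] := gi; rewrite /block si gi perm_rcons perm_sym.
by apply: perm_to_rem; have [] := edge_size_mem i.
Qed.

(** If [i] carries arcs and the two edge sizes agree, that size occurs at least twice in [W i], so
    both removals in [block] take effect. *)
Lemma block_not_glued (i : int) : ~~ glued i -> perm_eq (e (i - 1) :: block i) (W i).
Proof.
move=> ngi; rewrite /block (negPf ngi); have [si|/not_spokeP[-> ->//]] := boolP (spoke i).
rewrite perm_sym (perm_trans (perm_to_rem (edge_size_pred i))) // perm_cons.
rewrite perm_sym perm_rcons perm_sym; apply: perm_to_rem.
rewrite -has_pred1 has_count count_rem edge_size_pred /=.
have [+ _] := edge_size_mem i; rewrite -has_pred1 has_count.
move: ngi; rewrite /glued si /=; by case: eqVneq => _ /=; lia.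
Qed.

Lemma block_ge3 (i : int) p : p \in block i -> (3 <= p)%N.
Proof.
move=> p_in; have [gi|ngi] := boolP (glued i).
  by apply: (@W_ge3 i); rewrite -(perm_mem (block_glued gi)).
by apply: (@W_ge3 i); rewrite -(perm_mem (block_not_glued ngi)) inE p_in orbT.
Qed.

Lemma block_spoke (i : int) : (0 < size (block i))%N = spoke i.
Proof. by rewrite /block; case: ifP => //; rewrite size_rcons. Qed.

Lemma size_block_glued (i : int) : glued i -> (1 < size (block i))%N.
Proof. by move=> gi; rewrite (perm_size (block_glued gi)); case/and3P: gi. Qed.

Let eN (i : int) : e (i + N%:Z) = e i.
Proof. by rewrite /e addrAC !WN. Qed.

Let gluedN (i : int) : glued (i + N%:Z) = glued i.
Proof. by rewrite /glued /spoke WN eN addrAC eN. Qed.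

Let blockN (i : int) : block (i + N%:Z) = block i.
Proof. by rewrite /block gluedN /spoke WN eN addrAC eN. Qed.

(** Arcs are numbered from left to right, and those at [i] have the numbers from [block_start i] to
    [block_start (i + 1) - 1]. Thus [block_start i - 1] numbers the polygon on the segment that ends
    at [i]. *)
Definition block_start : int -> int := int_sum (fun i => (size (block i))%:Z).

Local Notation F := block_start.

Let FS (i : int) : F (i + 1) = F i + (size (block i))%:Z.
Proof. exact: int_sumS. Qed.

Let FleS (i : int) : F i <= F (i + 1).
Proof. by rewrite FS; lia. Qed.

Let F_mono (i j : int) : i <= j -> F i <= F j.
Proof. exact: int_mono_step. Qed.

Let FN (i : int) : F (i + N%:Z) = F i + F N%:Z.
Proof. by apply: int_sum_shift => j; rewrite blockN. Qed.

(** No vertex from [x + 1] to [y] carries an arc, so each has a single entry there, which forces the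
    edge sizes on both of its sides. *)
Lemma edge_size_run (x y : int) : x <= y -> F (x + 1) = F (y + 1) ->
  e y = e x /\ forall u : int, x < u <= y -> W u = [:: e x].
Proof.
move=> xy; have -> : y = x + `|y - x|%N%:Z by lia.
elim: `|y - x|%N => [|d IH]; first by rewrite addr0; split=> // u; lia.
rewrite (_ : x + d.+1%:Z = x + d%:Z + 1); last by lia.
set z : int := x + d%:Z in IH * => Fz.
have Fz1 : F (x + 1) = F (z + 1).
  have := FleS (z + 1); have : F (x + 1) <= F (z + 1) by apply: F_mono; lia.
  lia.
have [ez Wz] := IH Fz1.
have : ~~ spoke (z + 1) by rewrite -block_spoke; have := FS (z + 1); lia.
move/not_spokeP; rewrite addrK => -[Wz1 ez1]; split; first by rewrite -ez1.
move=> u uP; have [->|neq] := eqVneq u (z + 1); first by rewrite Wz1 -ez1 ez.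
by apply: Wz; lia.
Qed.

(** Without any arc, all [W i] would be one and the same singleton, which is an endless run. *)
Lemma block_start_period_gt0 : 0 < F N%:Z.
Proof.
rewrite ltNge; apply/negP => FN0.
have no_spoke (i : int) : ~~ spoke i.
  rewrite -block_spoke; have := FN i.
  have : F (i + 1) <= F (i + N%:Z) by apply: F_mono; lia.
  have := FS i; lia.
have F_const (i : int) : F i = 0.
  have FS0 (j : int) : F (j + 1) = F j.
    by rewrite FS; have := no_spoke j; rewrite -block_spoke; lia.
  by elim/int_ind_step: i => [|i <-|i <-]; rewrite ?FS0 //; apply: int_sum0.
case: (@W_no_run (e 0) 0 (edge_size_ge3 0)) => k _.
(* Starting at -1 makes the run include the vertex 0. *)
have run (y : int) := @edge_size_run (-1) y.
have [||_ ->] := run (0 + k%:Z); [by lia|by rewrite !F_const| |by lia].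
by have [||-> _] := run 0; [lia|rewrite !F_const|].
Qed.

(** * Positions of the arcs and sizes of the polygons between them *)

Section Layout.
(* The arc k starts at Out (o k). *)
Variable o : int -> int.
Hypothesis oP : forall k : int, F (o k) <= k < F (o k + 1).

Definition polygon_size (k : int) : nat := nth 0%N (block (o k)) `|k - F (o k)|%N.

Local Notation p := polygon_size.

(** The summand is the number of inner edges of the polygon [k]: its size minus its two arcs and its
    outer edges. *)
Definition inner_position : int -> int :=
  int_sum (fun k => (p k)%:Z - 2 - (o (k + 1) - o k)).

Local Notation a := inner_position.
(* Doubling the period makes the two polygons at a glued vertex inequivalent  *)
(* under the deck group, and the number of breaks even.                       *)
Local Notation n := (N + N)%N.
Local Notation K := (F N%:Z + F N%:Z).

(** A Galois connection between vertices and arc numbers, through which most later comparisons are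
    translated. *)
Let F_le_o (i k : int) : (F i <= k) = (i <= o k).
Proof.
have := oP k; apply: contraTeq.
case: (leP i (o k)) => [/F_mono|lt_oi]; first by lia.
have : F (o k + 1) <= F i by apply: F_mono; lia.
by lia.
Qed.

Let k_lt_F (i k : int) : (k < F i) = (o k < i).
Proof. by rewrite !ltNge F_le_o. Qed.

Let oS (k : int) : o k <= o (k + 1).
Proof. by rewrite -F_le_o; have := oP k; lia. Qed.

Let FK (i : int) : F (i + n%:Z) = F i + K.
Proof. by rewrite PoszD addrA !FN addrA. Qed.

Let oK (k : int) : o (k + K) = o k + n%:Z.
Proof.
have le_iff (i : int) : (i <= o (k + K)) = (i - n%:Z <= o k).
  by have := FK (i - n%:Z); rewrite subrK -!F_le_o => ->; rewrite lerD2r.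
by have := le_iff (o (k + K)); have := le_iff (o k + n%:Z); lia.
Qed.

Let nS (i : int) : block (i + n%:Z) = block i.
Proof. by rewrite PoszD addrA !blockN. Qed.

Let pK (k : int) : p (k + K) = p k.
Proof. by rewrite /p oK nS FK; congr nth; lia. Qed.

Let size_block_gt (k : int) : (`|k - F (o k)| < size (block (o k)))%N.
Proof. by have := oP k; rewrite FS; lia. Qed.

Lemma polygon_size_ge3 (k : int) : (3 <= p k)%N.
Proof. by apply: (@block_ge3 (o k)); rewrite mem_nth. Qed.

(** This polygon is the last one in the block of the last vertex up to [i] that carries arcs, and
    edge sizes are constant from there to [i]. *)
Lemma polygon_size_edge (i : int) : p (F (i + 1) - 1) = e i.
Proof.
have [k kE] : exists k : int, k = F (i + 1) - 1 by exists (F (i + 1) - 1).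
rewrite -kE; have okP := oP k.
have le_oi : o k <= i by rewrite -ltzD1 -k_lt_F; lia.
have F_le : F (o k + 1) <= F (i + 1) by apply: F_mono; lia.
have F_eq : F (o k + 1) = F (i + 1) by lia.
have [-> _] := edge_size_run le_oi F_eq.
have := size_block_gt k; rewrite /p.
have -> : `|k - F (o k)|%N = (size (block (o k))).-1.
  by have := FS (o k); rewrite F_eq; lia.
rewrite nth_last /block; case: ifP => // _ _.
by rewrite last_rcons.
Qed.

(** A wider polygon would have at least [p k - 2] vertices strictly between its arcs, each with
    [p k] as its only entry, contrary to [W_no_run]. *)
Lemma polygon_width (k : int) : o (k + 1) - o k <= (p k)%:Z - 2.
Proof.
have p3 := polygon_size_ge3 k.
have [lt_k|le_k] := ltP (k + 1) (F (o k + 1)).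
  by have := lt_k; rewrite k_lt_F; have := oS k; lia.
have FE : F (o k + 1) = k + 1 by have := oP k; lia.
have pE : p k = e (o k) by rewrite -polygon_size_edge FE addrK.
rewrite leNgt; apply/negP => too_wide.
have ge3 : (3 <= e (o k))%N by rewrite -pE.
apply: (W_no_run ge3 (i := o k + 1)) => j j_lt.
have [||_ ->//] := @edge_size_run (o k) (o (k + 1) - 1).
- by lia.
- rewrite subrK FE; apply/eqP; rewrite eq_le.
  by have := oP (k + 1); have := F_mono (i := o k + 1) (j := o (k + 1)); lia.
- by rewrite -pE in j_lt; lia.
Qed.

Let aE (k : int) : a (k + 1) = a k + ((p k)%:Z - 2 - (o (k + 1) - o k)).
Proof. exact: int_sumS. Qed.

Let aS (k : int) : a k <= a (k + 1).
Proof. by rewrite aE; have := polygon_width k; lia. Qed.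

Let oaS (k : int) : o k + a k < o (k + 1) + a (k + 1).
Proof. by rewrite aE; have := polygon_size_ge3 k; lia. Qed.

Let aK0 (k : int) : a (k + K) = a k + a K.
Proof.
apply: int_sum_shift => l; rewrite pK (_ : l + K + 1 = l + 1 + K); last by lia.
by rewrite !oK; lia.
Qed.

Let K_gt0 : 0 < K.
Proof. by have := block_start_period_gt0; lia. Qed.

Let n_gt0 : (0 < n)%N. Proof. by lia. Qed.

Definition inner_period : nat := `|a K|%N.
Local Notation m := inner_period.

Let aK (k : int) : a (k + K) = a k + m%:Z.
Proof.
rewrite aK0 /m; have : a 0 <= a K by apply: (int_mono_step aS); lia.
have -> : a 0 = 0 by exact: int_sum0.
by lia.
Qed.

Let layout : bridging n m o a K.
Proof. by split. Qed.

Local Notation S := (bridged_surface n m).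
Local Notation D := (bridges m o a).
Local Notation P := (bridge_polygon m o a).

Let size_P (k : int) : size (P k) = p k.
Proof.
have := size_bridge_polygon layout k.
by rewrite aE; have := polygon_width k; lia.
Qed.

(** The first index belongs to the polygon left of all arcs at [i]; it is the only one if [i]
    carries no arc. *)
Definition corner_indices (i : int) : seq int :=
  [seq F i - 1 + j%:Z | j <- iota 0 (size (block i)).+1].

Local Notation ks := corner_indices.

Lemma mem_corner_indices (i k : int) : (k \in ks i) = (o k <= i <= o (k + 1)).
Proof.
rewrite -F_le_o -(ltzD1 (o k)) -k_lt_F FS; apply/mapP/idP => [[j]|kP].
  by rewrite mem_iota => ? ->; lia.
by exists `|k - (F i - 1)%R|%N; [rewrite mem_iota|]; lia.
Qed.

Lemma corner_indices_uniq (i : int) : uniq (ks i).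
Proof. by rewrite map_inj_uniq ?iota_uniq // => x y; lia. Qed.

Lemma corner_indices_sizes (i : int) :
  [seq size (P k) | k <- ks i] = e (i - 1) :: block i.
Proof.
rewrite (eq_map size_P) /ks /= addr0 -{1}(subrK 1 i) polygon_size_edge; congr cons.
rewrite -[RHS](mkseq_nth 0%N) /mkseq (iotaDl 1 0) -!map_comp.
apply/eq_in_map => j; rewrite mem_iota /= => j_lt.
have oE : o (F i - 1 + (1 + j)%N%:Z) = i.
  apply/eqP; rewrite eq_le -ltzD1 -k_lt_F -F_le_o FS; lia.
by rewrite /p oE; congr nth; lia.
Qed.

(** At a break the polygons on the two adjacent segments have to remain distinct. *)
Definition break (i : int) : bool := spoke i && ~~ glued i.

Definition break_count : int -> int := int_sum (fun i => (break i)%:Z).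

Local Notation C := break_count.
Local Notation c := (C N%:Z + C N%:Z).

Let CS (i : int) : C (i + 1) = C i + (break i)%:Z.
Proof. exact: int_sumS. Qed.

Let CN (i : int) : C (i + N%:Z) = C i + C N%:Z.
Proof.
by apply: int_sum_shift => j; rewrite /break gluedN /spoke WN.
Qed.

Let CK (i : int) : C (i + n%:Z) = C i + c.
Proof. by rewrite PoszD addrA !CN addrA. Qed.

Let C_mono (i j : int) : i <= j -> C i <= C j.
Proof. by apply: int_mono_step => x; rewrite CS; lia. Qed.

Let C_const (i j : int) : i <= j -> F i = F j -> C i = C j.
Proof.
move=> ij F_eq; have := C_mono ij.
have : F i - C i <= F j - C j.
  apply: (@int_mono_step (fun x => F x - C x)) => // x; rewrite FS CS.
  by have := block_spoke x; rewrite /break; case: (spoke x) => /=; lia.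
by lia.
Qed.

(* Two polygons with a common label are identified: middle polygons are only  *)
(* identified with their translates, and the others whenever no break lies    *)
(* between them.                                                              *)
Definition label (k : int) : bool * int :=
  if o k < o (k + 1) then (true, (C (o k + 1) %% c)%Z) else (false, (k %% K)%Z).

Let labelK (k : int) : label (k + K) = label k.
Proof.
rewrite /label (_ : k + K + 1 = k + 1 + K); last by lia.
rewrite !oK (_ : o k + n%:Z + 1 = o k + 1 + n%:Z); last by lia.
by rewrite CK !modzDr ltrD2r.
Qed.

Lemma label_edge (i : int) : label (F i - 1) = (true, (C i %% c)%Z).
Proof.
have [k kE] : exists k : int, k = F i - 1 by exists (F i - 1).
have lt_oi : o k < i by rewrite -k_lt_F; lia.
have le_io : i <= o (k + 1) by rewrite -F_le_o; lia.
rewrite -kE /label ifT; last by lia.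
have F_le : F (o k + 1) <= F i by apply: F_mono; lia.
by congr (_, (_ %% _)%Z); apply: C_const; have := oP k; lia.
Qed.

Lemma label_middle (i k : int) : F i <= k -> k + 1 < F (i + 1) ->
  label k = (false, (k %% K)%Z).
Proof.
by rewrite F_le_o k_lt_F => le_i lt_i; rewrite /label ifF //; have := oS k; lia.
Qed.

(** The count rises by 1 at [i]. One break already gives [C N%:Z] at least 1, so the doubled modulus
    is at least 2. *)
Lemma break_label_neq (i : int) : break i -> (C i %% c)%Z <> (C (i + 1) %% c)%Z.
Proof.
move=> bi /eqP; rewrite eq_sym eqz_mod_dvd CS bi addrAC subrr add0r => /dvdzP[q].
have := CN i; have : C (i + 1) <= C (i + N%:Z) by apply: C_mono; lia.
by rewrite CS bi; nia.
Qed.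

(** If both polygons have outer edges, the vertex between them carries just one arc; a glued vertex
    carries at least two, so this one is a break. Two middle polygons differ because [K] is at least
    2. *)
Lemma label_step (k : int) : label k <> label (k + 1).
Proof.
rewrite {1}/label; case: ltP => [big_k|mid_k].
  have F_eq : F (o (k + 1)) = k + 1.
    have := oP (k + 1); have := oP k.
    by have := F_mono (i := o k + 1) (j := o (k + 1)); lia.
  have C_eq : C (o k + 1) = C (o (k + 1)).
    apply: C_const; first by lia.
    by have := oP k; have := F_mono (i := o k + 1) (j := o (k + 1)); lia.
  rewrite C_eq /label; case: ltP => // big_k1 [].
  apply: break_label_neq.
  have := oP (k + 1); rewrite FS F_eq => kP.
  have le1 : F (o (k + 1) + 1) <= k + 1 + 1 by rewrite F_le_o; lia.
  rewrite /break -block_spoke; apply/andP; split; first by lia.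
  by apply/negP => /size_block_glued; move: le1; rewrite FS F_eq; lia.
rewrite /label; case: ltP => // _ [] /eqP; rewrite eq_sym eqz_mod_dvd addrAC subrr add0r.
by move=> /dvdzP[q]; have := block_start_period_gt0; nia.
Qed.

Let P_inj := bridge_polygon_inj layout.
Let cornerP := bridge_cornerP layout.

Let corner_sizes_not_glued (i : int) : ~~ glued i ->
  seq_mset (W i) = seq_mset [seq size Q | Q <- map P (ks i)].
Proof.
move=> ngi; apply/eq_seq_msetP.
by rewrite -map_comp corner_indices_sizes perm_sym block_not_glued.
Qed.

Let mem_cornersP (i : int) Q : Q \in map P (ks i) <-> corner S D i Q.
Proof.
rewrite cornerP; split=> [/mapP[k]|[k ->]].
  by rewrite mem_corner_indices => kP ->; exists k.
by rewrite -mem_corner_indices => /map_f; apply.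
Qed.

Lemma punctured_realization : m = 0%N ->
  dissection (PuncturedDisc n) D /\
  forall i : int, corner_sizes (PuncturedDisc n) D i (seq_mset (W i)).
Proof.
move=> m0; have SE : PuncturedDisc n = S by rewrite /S m0.
rewrite SE; split; first exact: bridges_dissection layout.
move=> i; exists (map P (ks i)); split.
- by rewrite (map_inj_uniq P_inj) corner_indices_uniq.
- exact: mem_cornersP.
apply: corner_sizes_not_glued; apply/negP => gi.
(* Polygons of width 0 have inner edges, of which there are none. *)
have gt1 := size_block_glued gi; have FSi := FS i.
have o0 : i <= o (F i) by rewrite -F_le_o.
have o1 : o (F i + 1) < i + 1 by rewrite -k_lt_F; lia.
have a1 : a (F i + 1) <= a (F i + K) by apply: (int_mono_step aS); lia.
have := polygon_size_ge3 (F i); have := aE (F i); have := aK (F i); rewrite m0.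
by have := oS (F i); lia.
Qed.

Lemma annular_realization : (0 < m)%N ->
  dissection (Annulus n m) D /\
  exists2 E, quotient_dissection (Annulus n m) D E &
    forall i : int, quotient_corner_sizes (Annulus n m) D E i (seq_mset (W i)).
Proof.
move=> m_gt0; have SE : Annulus n m = S by rewrite /S m_gt0.
rewrite SE; split; first exact: bridges_dissection layout.
(* One period of glued vertices is enough: translates follow because [E] contains [same_subgon]. *)
pose pairs := [seq (F i%:Z - 1, F (i%:Z + 1) - 1) | i <- iota 0 n & glued i%:Z].
have label_glued (i : int) : glued i -> label (F i - 1) = label (F (i + 1) - 1).
  by move=> gi; rewrite !label_edge CS /break gi andbF addr0.
have [|E [quotE equivE subE pairsE labelE]] :=
  bridge_quotient layout m_gt0 (phi := label) (pairs := pairs) labelK label_step.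
  move=> k l /mapP[i]; rewrite mem_filter => /andP[gi _] klE.
  have -> : k = F i%:Z - 1 := congr1 fst klE.
  have -> : l = F (i%:Z + 1) - 1 := congr1 snd klE.
  have /and3P[_ /eqP eE _] := gi; split; first exact: label_glued.
    by rewrite !size_P -{1}(subrK 1 i%:Z) !polygon_size_edge.
  have gt1 := size_block_glued gi.
  have kS (j : int) : j <= j + 1 by lia.
  exists i%:Z; rewrite !(mem_span_out layout) // -!mem_corner_indices.
  by split; apply/mapP; [exists 0%N|exists (size (block i%:Z))];
    rewrite ?mem_iota ?FS //; lia.
have gluedE (i : int) : glued i -> E (P (F i - 1)) (P (F (i + 1) - 1)).
  move=> gi; pose r := (i %% n%:Z)%Z; pose q := (i %/ n%:Z)%Z.
  have r_ge0 : 0 <= r by apply: modz_ge0; lia.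
  have r_lt : r < n%:Z by apply: ltz_pmod; lia.
  have iE : i = r + n%:Z * q by rewrite {1}(divz_eq i n%:Z) mulrC addrC.
  have gluedn (x : int) : glued (x + n%:Z) = glued x.
    by rewrite PoszD addrA !gluedN.
  have gluedM (t x : int) : glued (x + n%:Z * t) = glued x.
    elim/int_ind_step: t => [|t IH|t IH]; first by rewrite mulr0 addr0.
      by rewrite (_ : x + _ = x + n%:Z * t + n%:Z) ?gluedn; lia.
    by rewrite -IH -gluedn; congr glued; lia.
  have rE : r = `|r|%N%:Z by lia.
  have Er : E (P (F r - 1)) (P (F (r + 1) - 1)).
    apply: pairsE; apply/mapP; exists `|r|%N.
      by rewrite mem_filter mem_iota -rE -(gluedM q) -iE gi /=; lia.
    by rewrite -rE.
  have shift (x : int) : same_subgon S (P (F x - 1)) (P (F (x + n%:Z * q) - 1)).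
    exists q; rewrite (bridge_polygon_deck layout); congr P.
    by rewrite (quasi_periodic_mul FK); lia.
  have := shift (r + 1); rewrite (_ : r + 1 + _ = i + 1); last by lia.
  have := shift r; rewrite -iE => Ei Ei1.
  apply: (equivalence_trans equivE) (subE _ _ (same_subgon_sym Ei)) _.
  exact: (equivalence_trans equivE) Er (subE _ _ Ei1).
have labelP (k l : int) : E (P k) (P l) -> label k = label l.
  by case/labelE=> l' /P_inj ->.
have middle_same (k l : int) : (k %% K)%Z = (l %% K)%Z -> same_subgon S (P k) (P l).
  move=> /eqP; rewrite eq_sym eqz_mod_dvd => /dvdzP[q qE].
  by exists q; rewrite (bridge_polygon_deck layout); congr P; lia.
exists E => // i.
have ksP (k : int) : k \in ks i -> [\/ k = F i - 1, k = F (i + 1) - 1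
    | label k = (false, (k %% K)%Z)].
  rewrite mem_corner_indices -F_le_o -(ltzD1 (o k)) -k_lt_F => kP.
  have [->|ne0] := eqVneq k (F i - 1); first by constructor 1.
  have [->|ne1] := eqVneq k (F (i + 1) - 1); first by constructor 2.
  by constructor 3; apply: (@label_middle i); lia.
have [gi|ngi] := boolP (glued i); last first.
  exists (map P (ks i)); split.
  - by rewrite (map_inj_uniq P_inj) corner_indices_uniq.
  - by move=> Q /mem_cornersP.
  (* Equal labels exclude a break; as [i] is not glued, it carries no arc and both segments at [i]
     lie on one polygon. *)
  - have edges : label (F i - 1) = label (F (i + 1) - 1) -> F i = F (i + 1).
      rewrite !label_edge => -[eq_mod]; rewrite FS.
      have [si|] := boolP (spoke i); last by rewrite -block_spoke; lia.
      by case: (@break_label_neq i); rewrite // /break si.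
    move=> _ _ /mapP[k /ksP kP ->] /mapP[l /ksP lP ->] /labelP.
    case: kP lP => [->|->|->] [->|->|->]; rewrite ?label_edge //.
    + by move=> _; apply: same_subgon_refl.
    + by rewrite -!label_edge => /edges ->; apply: same_subgon_refl.
    + by rewrite -!label_edge => /esym/edges ->; apply: same_subgon_refl.
    + by move=> _; apply: same_subgon_refl.
    + by case=> /middle_same.
  - move=> Q _; exists id; split=> [Q' _ /mem_cornersP Q'in|//].
    by split=> //; apply/subE/same_subgon_refl.
  exact: corner_sizes_not_glued.
have gt1 := size_block_glued gi; have FSi := FS i.
have ksE : ks i = F i - 1 :: behead (ks i) by rewrite /ks /= addr0.
have := corner_indices_uniq i; rewrite ksE /= => /andP[notin uniq_ks].
have last_in : F (i + 1) - 1 \in behead (ks i).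
  have : F (i + 1) - 1 \in ks i.
    by apply/mapP; exists (size (block i)); rewrite ?mem_iota ?FS //; lia.
  by rewrite ksE inE => /predU1P[|//]; lia.
exists (map P (behead (ks i))); split.
- by rewrite (map_inj_uniq P_inj).
- move=> Q /mapP[k k_in ->]; apply/mem_cornersP/map_f.
  by rewrite ksE inE k_in orbT.
- have ksP' (k : int) : k \in behead (ks i) ->
      k = F (i + 1) - 1 \/ label k = (false, (k %% K)%Z).
    move=> k_in; have : k \in ks i by rewrite ksE inE k_in orbT.
    by case/ksP=> [kE||]; [move: k_in notin; rewrite kE => ->|left|right].
  move=> _ _ /mapP[k /ksP' kP ->] /mapP[l /ksP' lP ->] /labelP.
  case: kP lP => [->|->] [->|->]; rewrite ?label_edge //.
    by move=> _; apply: same_subgon_refl.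
  by case=> /middle_same.
(* The omitted corner is represented by its partner across [i]. This is injective on deck orbits
   because the two are not translates of each other. *)
- move=> Q _; pose f X := if X == P (F i - 1) then P (F (i + 1) - 1) else X.
  exists f; rewrite /f; split=> [X _ /mem_cornersP/mapP[k k_in ->]|].
    case: eqP => [->|neq]; first by split; [exact: map_f | exact: gluedE].
    split; last by apply/subE/same_subgon_refl.
    apply: map_f; move: k_in; rewrite ksE inE => /predU1P[kE|//].
    by case: neq; rewrite kE.
  (* The indices differ by a positive number that is at most [F N%:Z], which is half of [K]. *)
  have not_same : ~ same_subgon S (P (F i - 1)) (P (F (i + 1) - 1)).
    move=> /(same_subgon_bridgeP layout)[t /P_inj tE].
    have le_FN : F (i + 1) <= F (i + N%:Z) by apply: F_mono; lia.
    have sE : (size (block i))%:Z = K * t by lia.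
    have lt_K : (size (block i))%:Z < K.
      by have := FN i; have := block_start_period_gt0; lia.
    have [t0|t1] : t <= 0 \/ 1 <= t by lia.
      have : K * t <= 0 by rewrite pmulr_rle0.
      by lia.
    have : K <= K * t by rewrite -[leLHS]mulr1 ler_wpM2l // ltW.
    by lia.
  move=> X Y QX _ QY _; have XY := same_subgon_trans (same_subgon_sym QX) QY.
  case: eqP => [XE|_]; case: eqP => [YE|_] //; first by rewrite XE YE.
    by move=> YE; case: not_same; rewrite -XE YE.
  by move=> XE; case: not_same; apply: same_subgon_sym; rewrite -XE -YE.
apply/eq_seq_msetP; rewrite perm_sym -map_comp.
rewrite (_ : map _ _ = block i) ?block_glued //.
by have := corner_indices_sizes i; rewrite ksE map_cons => -[].
Qed.

End Layout.

Lemma prescribed_realization : exists (m : nat) (D : rel vertex),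
  (dissection (PuncturedDisc (N + N)) D /\
   forall i : int, corner_sizes (PuncturedDisc (N + N)) D i (seq_mset (W i))) \/
  (dissection (Annulus (N + N) m) D /\
   exists2 E, quotient_dissection (Annulus (N + N) m) D E &
     forall i : int,
       quotient_corner_sizes (Annulus (N + N) m) D E i (seq_mset (W i))).
Proof.
have /choice[o oP] := int_locate FleS FN block_start_period_gt0.
exists (inner_period o), (bridges (inner_period o) o (inner_position o)).
have [m0|m_gt0] := posnP (inner_period o).
  by left; apply: punctured_realization.
by right; apply: annular_realization.
Qed.

End Prescribed.

(** * Finiteness of the representations of a quiddity entry *)

Section Lambda.
Variable R : realType.
Implicit Types (x y : R) (p q : nat).
Local Notation lambda := (lambda R).

Let angle_itv p : (0 < p)%N -> (pi / p%:R : R) \in `[0, pi].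
Proof.
move=> p0; rewrite in_itv /= divr_ge0 ?pi_ge0 //=.
by rewrite ler_pdivrMr ?ltr0n // ler_peMr ?pi_ge0 // ler1n.
Qed.

Lemma lambda_lt p q : (0 < p < q)%N -> lambda p < lambda q.
Proof.
case/andP=> p0 pq; have q0 : (0 < q)%N := leq_ltn_trans (leq0n _) pq.
rewrite /lambda ltr_pM2l ?ltr0n // ltr_cos ?angle_itv //.
by rewrite ltr_pM2l ?pi_gt0 // ltf_pV2 ?posrE ?ltr0n // ltr_nat.
Qed.

Lemma lambda_lt2 p : (0 < p)%N -> lambda p < 2.
Proof.
move=> p0; rewrite /lambda -[ltRHS]mulr1 ltr_pM2l ?ltr0n // -[ltRHS](cos0 R).
rewrite ltr_cos ?angle_itv //; last by rewrite in_itv /= lexx pi_ge0.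
by rewrite divr_gt0 ?pi_gt0 ?ltr0n.
Qed.

Lemma lambda3_gt0 : 0 < lambda 3.
Proof.
rewrite /lambda mulr_gt0 ?ltr0n // cos_gt0_pihalf //.
have := pi_gt0 R; lra.
Qed.

Lemma lambda_ge_lambda3 p : (3 <= p)%N -> lambda 3 <= lambda p.
Proof.
by rewrite leq_eqVlt => /predU1P[<-//|p3]; apply/ltW/lambda_lt.
Qed.

Lemma lambda_near2 y : y < 2 ->
  exists b : nat, forall p, (b <= p)%N -> y < lambda p.
Proof.
(* The maximum with 0 keeps [z] in the domain of [acos] however small [y] is. *)
move=> y2; pose z : R := Num.max 0 (y / 2).
have z0 : 0 <= z by rewrite le_max lexx.
have zy : y / 2 <= z by rewrite le_max lexx orbT.
have z1 : z < 1 by rewrite gt_max ltr01; lra.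
have z1' : -1 <= z by lra.
have az : 0 < acos z by rewrite acos_gt0 // z1'.
exists (Num.truncn (pi / acos z)).+1 => p le_p.
have p0 : (0 < p)%N by exact: leq_trans le_p.
have lt_angle : pi / p%:R < acos z.
  rewrite ltr_pdivrMr ?ltr0n // mulrC -ltr_pdivrMr //.
  by apply: lt_le_trans (truncnS_gt _) _; rewrite ler_nat.
have : z < cos (pi / p%:R).
  rewrite -[ltLHS](@acosK R) ?in_itv /= ?z1' ?(ltW z1) //.
  by rewrite ltr_cos ?angle_itv // in_itv /= (ltW az) acos_lepi // z1' ltW.
rewrite /lambda; lra.
Qed.

Lemma mem_le_average (s : seq nat) y : (0 < size s)%N ->
  \sum_(p <- s) lambda p <= y *+ size s -> exists2 p, p \in s & lambda p <= y.
Proof.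
move=> s0 sum_le; apply: contrapT => none.
have : {in s, forall p, y < lambda p}.
  by move=> p ps; rewrite ltNge; apply/negP => le_y; apply: none; exists p.
move/allP; move: sum_le s0 {none}; elim: s => //= p [|q s] IH.
  rewrite big_seq1 mulr1n => le_y _; rewrite andbT => /lt_le_trans/(_ le_y).
  by rewrite ltxx.
rewrite big_cons mulrS => sum_le _ /andP[lt_p all_s].
by apply: IH => //; lra.
Qed.

(** Some term is at most the average, which is below 2, so [lambda_near2] bounds the corresponding
    [p]. Removing that [p] leaves finitely many smaller problems. *)
Lemma lambda_sum_finite_size (k : nat) x : exists L : seq (seq nat),
  forall s : seq nat, size s = k -> {in s, forall p, (3 <= p)%N} ->
    \sum_(p <- s) lambda p = x -> exists2 t, t \in L & perm_eq s t.
Proof.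
elim: k x => [|k IH] x.
  by exists [:: [::]] => s /size0nil -> _ _; exists [::]; rewrite ?inE.
have /choice[L LP] := IH.
have [b bP] : exists b : nat, forall s, size s = k.+1 ->
    {in s, forall p, (3 <= p)%N} -> \sum_(p <- s) lambda p = x ->
    exists2 p, p \in s & (p < b)%N.
  pose y := x / k.+1%:R.
  have small s : size s = k.+1 -> \sum_(p <- s) lambda p = x ->
      exists2 p, p \in s & lambda p <= y.
    move=> sk sx; apply: mem_le_average; rewrite sk // sx.
    by rewrite -[_ *+ k.+1]mulr_natr /y divfK // pnatr_eq0.
  have [y2|y2] := ltP y 2.
    have [b bP] := lambda_near2 y2; exists b => s sk _ sx.
    have [p ps le_y] := small s sk sx; exists p => //.
    by rewrite ltnNge; apply/negP => /bP; rewrite ltNge le_y.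
  (* An average of at least 2 is never attained. *)
  exists 0%N => s sk s3 sx.
  have: \sum_(p <- s) (2 - lambda p) <= 0.
    rewrite sumrB sx big_const_seq count_predT iter_addr addr0 sk.
    by rewrite subr_le0 -[_ *+ k.+1]mulr_natr -ler_pdivlMr ?ltr0n.
  rewrite leNgt => /negP[].
  move: sk s3 {sx small}; case: s => // p s _ s3.
  rewrite big_cons ltr_pwDl // ?subr_gt0 ?lambda_lt2 //.
    by apply: (@leq_trans 3) => //; apply: s3; rewrite mem_head.
  rewrite big_seq sumr_ge0 // => q qs; rewrite subr_ge0 ltW // lambda_lt2 //.
  by apply: (@leq_trans 3) => //; apply: s3; rewrite inE qs orbT.
exists [seq p :: t | p <- iota 0 b, t <- L (x - lambda p)] => s sk s3 sx.
have [p ps pb] := bP s sk s3 sx; have perm_s := perm_to_rem ps.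
have [|||t tL perm_t] := LP (x - lambda p) (rem p s).
- by rewrite size_rem // sk.
- by move=> q /mem_rem; apply: s3.
- by rewrite -sx (perm_big _ perm_s) big_cons addrC addKr.
exists (p :: t); first by apply: allpairs_f_dep => //; rewrite mem_iota.
by rewrite (perm_trans perm_s) // perm_cons.
Qed.

(** Every term is at least [lambda 3 > 0], which bounds the number of terms. *)
Lemma lambda_sum_finite x : exists L : seq {mset nat}, forall A : {mset nat},
  (forall p, p \in A -> (3 <= p)%N) -> \sum_(p <- A) lambda p = x -> A \in L.
Proof.
have /choice[L LP] := lambda_sum_finite_size ^~ x.
pose M := (Num.truncn (x / lambda 3)).+1.
exists [seq seq_mset t | t <- flatten [seq L k | k <- iota 0 M]] => A A3 Ax.
have size_A : (size A < M)%N.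
  rewrite ltnS truncn_ge_nat; last first.
    rewrite divr_ge0 ?(ltW lambda3_gt0) // -Ax big_seq sumr_ge0 // => p pA.
    by apply: le_trans (lambda_ge_lambda3 (A3 p pA)); exact: ltW lambda3_gt0.
  rewrite ler_pdivlMr ?lambda3_gt0 // -Ax mulr_natl.
  rewrite -[leLHS]addr0 -iter_addr -count_predT -big_const_seq.
  by rewrite big_seq [leRHS]big_seq ler_sum // => p /A3/lambda_ge_lambda3.
have [t tL perm_t] := LP _ A erefl A3 Ax.
apply/mapP; exists t.
  by apply/flattenP; exists (L (size A)) => //; rewrite map_f // mem_iota.
by rewrite -[LHS]seq_mset_id; apply/eq_seq_msetP.
Qed.

End Lambda.

(** At multiples of the quiddity period [A] takes finitely many values, so two of them agree, and
    the window between them is repeated. Neighbouring multisets of [A'] are neighbours in [A], so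
    they still have a common entry. *)
Lemma periodic_prescription (R : realType) (m : int -> int -> R)
    (A : int -> {mset nat}) :
  periodic_frieze m ->
  (forall (i : int) (p : nat), p \in A i -> (3 <= p)%N) ->
  (forall i : int, quiddity m i = \sum_(p <- A i) lambda R p) ->
  exists (N : nat) (A' : int -> {mset nat}),
    [/\ (0 < N)%N, n_periodic N m, forall i : int, A' (i + N%:Z) = A' i,
        forall i : int, exists j : int, A' i = A j /\ A' (i + 1) = A (j + 1)
      & forall i : int, quiddity m i = \sum_(p <- A' i) lambda R p].
Proof.
move=> [n0 n0_gt0 per] A_ge3 qA.
have perM (t i : int) : quiddity m (i + n0%:Z * t) = quiddity m i.
  elim/int_ind_step: t => [|t IH|t IH]; first by rewrite mulr0 addr0.
    by rewrite -IH (per (i + n0%:Z * t)); congr quiddity; lia.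
  by rewrite -IH (per (i + n0%:Z * t)); congr quiddity; lia.
have [L LP] := lambda_sum_finite (quiddity m 0).
pose B (j : nat) := A (n0%:Z * j%:Z).
have B_in j : B j \in L.
  apply: LP => [p|]; first exact: A_ge3.
  by rewrite -qA -(perM j%:Z 0) add0r.
have /(uniqPn mset0)[j [j' [jj' j'_lt]]] : ~~ uniq (mkseq B (size L).+1).
  have sub : {subset mkseq B (size L).+1 <= L} by move=> _ /mapP[k _ ->].
  by apply/negP => /uniq_leq_size/(_ sub); rewrite size_mkseq ltnn.
rewrite size_mkseq in j'_lt.
rewrite !nth_mkseq //; last exact: ltn_trans jj' j'_lt.
rewrite /B => A_eq.
pose N := (n0 * (j' - j))%N; pose b : int := n0%:Z * j%:Z.
have N_gt0 : (0 < N)%N by rewrite muln_gt0 n0_gt0 subn_gt0.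
have NE : N%:Z = n0%:Z * (j'%:Z - j%:Z) by rewrite /N; nia.
have A_b : A (b + N%:Z) = A b by rewrite A_eq; congr A; rewrite /b NE; lia.
exists N, (fun i => A (b + (i %% N%:Z)%Z)); split=> //.
- by move=> i; rewrite NE perM.
- by move=> i; rewrite modzDr.
- move=> i; exists (b + (i %% N%:Z)%Z); split=> //.
  have := modz_ge0 i (_ : N%:Z != 0); have := ltz_pmod i (_ : 0 < N%:Z).
  rewrite -(modzDml i 1); move: (i %% N%:Z)%Z => r r_lt r_ge0.
  (* At the seam the window restarts, and [A_b] says that this agrees with continuing along [A]. *)
  have [rE|neq] := eqVneq (r + 1) N%:Z.
    by rewrite rE modzz addr0 -A_b; congr A; lia.
  by rewrite modz_small ?addrA //; lia.
move=> i; rewrite -qA; transitivity (quiddity m (i %% N%:Z)%Z).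
  rewrite -(perM ((i %/ N%:Z)%Z * (j'%:Z - j%:Z)) (i %% N%:Z)%Z).
  by rewrite {1}(divz_eq i N%:Z) {2}NE mulrCA addrC.
by rewrite -(perM j%:Z (i %% N%:Z)%Z) addrC.
Qed.

Theorem theorem5p14 (R : realType) (m : int -> int -> R)
    (s : nat) (ps : 'I_s -> nat) (A : int -> {mset nat})
    (ps_ge3 : forall k : 'I_s, (3 <= ps k)%N)
    (frieze_m : infinite_frieze m)
    (periodic_m : periodic_frieze m)
    (type_m : type_Lambda ps m)
    (A_ge3 : forall (i : int) (p : nat), p \in A i -> (3 <= p)%N)
    (quiddity_A : forall i : int, quiddity m i = \sum_(p <- A i) lambda R p)
    (skeletal_m : skeletal m)
    (test_A : passes_realizability_test A) :
  realizable m \/ has_quotient_realization m.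
Proof.
have [N [A' [N_gt0 perN A'N A'A qA']]] :=
  periodic_prescription periodic_m A_ge3 quiddity_A.
have A'_ge3 (i : int) p : p \in enum_mset (A' i) -> (3 <= p)%N.
  by have [j [-> _]] := A'A i; apply: A_ge3.
have A'_common (i : int) : has (mem (enum_mset (A' (i + 1)))) (enum_mset (A' i)).
  have [j [-> ->]] := A'A i; apply/negPn/negP => /hasPn none.
  case: test_A => -[]; exists j; apply/msetP => p; rewrite mset0E.
  apply/eqP; rewrite mset_eq0 in_msetI; apply/negP => /andP[/none/negP notin].
  by move=> /notin.
(* Singletons make the quiddity entries equal to [lambda p], so the skeletal condition applies
   directly to [A']. *)
have no_run p (i : int) : (3 <= p)%N ->
    ~ (forall k : nat, (k < p - 2)%N -> enum_mset (A' (i + k%:Z)) = [:: p]).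
  move=> p3 run; have := skeletal_m p i (p - 2)%N p3; rewrite ltnn => absurd.
  by suff: false by []; apply: absurd => k /run E; rewrite qA' E big_seq1.
have WN (i : int) : enum_mset (A' (i + N%:Z)) = enum_mset (A' i) by rewrite A'N.
have [n' [D real_D]] := prescribed_realization N_gt0 WN A'_ge3 A'_common no_run.
have per : n_periodic (N + N) m.
  by move=> i; rewrite perN (perN (i + _)) PoszD addrA.
case: real_D => [[diss corners]|[diss [E quotE corners]]]; [left|right].
  exists (N + N)%N; split=> //; right; exists D; split=> // i.
  exists (seq_mset (enum_mset (A' i))); first exact: corners.
  by rewrite qA' seq_mset_id.
exists (N + N)%N, n', D, E; split=> // i.
exists (seq_mset (enum_mset (A' i))); first exact: corners.
by rewrite qA' seq_mset_id.
Qed.
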